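(* Let $\mathfrak g=\mathring{\mathfrak g}\otimes\mathbb C[t^{\pm}]\oplus\mathbb Cc\oplus\mathbb Cd$ be an untwisted affine Kac-Moody algebra. Then $\mathfrak s$ is a maximal symmetric regular subalgebra of $\mathfrak g$ if and only if one of the following conditions holds: - $\mathfrak s=[\mathfrak g,\mathfrak g]$; - there exists a maximal closed subroot system $\mathring\Psi\subsetneq\mathring\Delta$ with $$\mathfrak s=\mathfrak h\oplus\bigoplus_{\substack{\alpha\in\mathring\Psi\\ r\in\mathbb Z}}\mathbb C(x_\alpha\otimes t^r)\oplus\bigoplus_{r\in\mathbb Z\setminus\{0\}}(\mathring{\mathfrak h}\otimes t^r);$$ - there exist a prime number $k$ and a $\mathbb Z$-linear function $f:\mathring\Delta\to\mathbb Z$ with $$\mathfrak s=\bigoplus_{\substack{\alpha\in\mathring\Delta\\ r\in\mathbb Z}}\mathbb C(x_\alpha\otimes t^{f(\alpha)+kr})\oplus\bigoplus_{r\in\mathbb Z}(\mathring{\mathfrak h}\otimes t^{kr})\oplus\mathbb Cc\oplus\mathbb Cd.$$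
   Context: $\mathring{\mathfrak g}$ is a finite-dimensional complex simple Lie algebra with Cartan subalgebra $\mathring{\mathfrak h}$, root system $\mathring\Delta$ and root vectors $x_\alpha$. $\mathfrak g=\mathring{\mathfrak g}\otimes\mathbb C[t^{\pm}]\oplus\mathbb Cc\oplus\mathbb Cd$ is the untwisted affine algebra with $c$ central and $d$ the degree derivation, with Cartan subalgebra $\mathfrak h=\mathring{\mathfrak h}\oplus\mathbb Cc\oplus\mathbb Cd$ and roots $\Delta=\Delta^{\mathrm{re}}\cup\Delta^{\mathrm{im}}$, $\Delta^{\mathrm{re}}=\{\alpha+r\delta:\alpha\in\mathring\Delta,r\in\mathbb Z\}$, $\Delta^{\mathrm{im}}=\{r\delta:r\in\mathbb Z\setminus\{0\}\}$. A regular subalgebra is an $\mathfrak h$-invariant Lie subalgebra $\mathfrak s\subseteq\mathfrak g$; $\Delta(\mathfrak s)=\{\alpha\in\Delta:\mathfrak g_\alpha\cap\mathfrak s\neq0\}$, and $\mathfrak s$ is symmetric if $\Delta(\mathfrak s)=-\Delta(\mathfrak s)$. A proper symmetric regular subalgebra is called maximal if it is not properly contained in any other proper symmetric regular subalgebra of $\mathfrak g$. A closed subroot system of $\mathring\Delta$ is a non-empty subset $\mathring\Psi$ with $s_\alpha(\beta)\in\mathring\Psi$ for $\alpha,\beta\in\mathring\Psi$ (where $s_\alpha$ is the reflection in $\alpha$) and such that $\alpha,\beta\in\mathring\Psi$, $\alpha+\beta\in\mathring\Delta$ implies $\alpha+\beta\in\mathring\Psi$; it is maximal if it is maximal with respect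 to inclusion among proper closed subroot systems of $\mathring\Delta$. A function $f:\mathring\Delta\to\mathbb Z$ is $\mathbb Z$-linear if it is the restriction of a $\mathbb Z$-linear map from the root lattice of $\mathring\Delta$ to $\mathbb Z$.
   Formalization: The empty set is also allowed as a closed subroot system; this matters only in rank 1 (affine sl_2), where h ⊕ ⊕_{r≠0} h̊⊗t^r is maximal but no non-empty proper closed subroot system exists; in rank ≥ 2 nothing changes. *)

(* Defs.v *)
From HB Require Import structures.
From mathcomp Require Import all_boot all_order all_algebra finmap.
From mathcomp Require Import boolp classical_sets functions cardinality fsbigop.
From mathcomp Require Import reals complex.

Set Implicit Arguments.
Unset Strict Implicit.
Unset Printing Implicit Defensive.

Import Order.TTheory GRing.Theory Num.Theory.

Local Open Scope classical_set_scope.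
Local Open Scope ring_scope.


HB.mixin Record Lmodule_isLie (K : fieldType) L of GRing.Lmodule K L := {
  lie : L -> L -> L;
  lie_linearl : forall y, linear (lie^~ y);
  lie_linearr : forall x, linear (lie x);
  liexx : forall x, lie x x = 0;
  lie_jacobi : forall x y z,
    lie x (lie y z) + lie y (lie z x) + lie z (lie x y) = 0
}.

#[short(type="lieType")]
HB.structure Definition Lie (K : fieldType) :=
  {L of Lmodule_isLie K L & GRing.Lmodule K L}.

#[short(type="vectLieType")]
HB.structure Definition VectLie (K : fieldType) :=
  {L of Lmodule_isLie K L & Vector K L}.

Notation "[lie x , y ]" := (lie x y) (at level 0, format "[lie  x ,  y ]").

Section LieTheory.
Variables (K : fieldType) (L : lieType K).
Implicit Types (x y z : L) (a : K).

Lemma lieDl x y z : [lie x + y, z] = [lie x, z] + [lie y, z].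
Proof. by have := lie_linearl z 1 x y; rewrite !scale1r. Qed.

Lemma lieDr x y z : [lie x, y + z] = [lie x, y] + [lie x, z].
Proof. by have := lie_linearr x 1 y z; rewrite !scale1r. Qed.

Lemma lie0r x : [lie x, 0] = 0.
Proof. by apply: (addrI [lie x, 0]); rewrite -lieDr !addr0. Qed.

Lemma lie0l x : [lie 0, x] = 0.
Proof. by apply: (addrI [lie 0, x]); rewrite -lieDl !addr0. Qed.

Lemma lieZr a x y : [lie x, a *: y] = a *: [lie x, y].
Proof. by have := lie_linearr x a y 0; rewrite !addr0 lie0r addr0. Qed.

Lemma lieZl a x y : [lie a *: x, y] = a *: [lie x, y].
Proof. by have := lie_linearl y a x 0; rewrite !addr0 lie0l addr0. Qed.

Lemma lieNr x y : [lie x, - y] = - [lie x, y].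
Proof. by rewrite -scaleN1r lieZr scaleN1r. Qed.

Lemma lieC x y : [lie x, y] = - [lie y, x].
Proof.
have := liexx (x + y); rewrite lieDl !lieDr !liexx add0r addr0.
by move/eqP; rewrite addr_eq0 => /eqP.
Qed.

End LieTheory.

Definition linear_subspace (K : fieldType) (V : lmodType K) (P : set V) : Prop :=
  P 0 /\ forall (a : K) u v, P u -> P v -> P (a *: u + v).

Definition lspan (K : fieldType) (V : lmodType K) (A : set V) : set V :=
  smallest (@linear_subspace K V) A.

Definition derived_algebra (K : fieldType) (L : lieType K) : set L :=
  lspan [set z | exists x y : L, z = [lie x, y]].
Arguments derived_algebra {K} L _.

Definition simple_lie (K : fieldType) (L : vectLieType K) : Prop :=
  (exists x y : L, [lie x, y] <> 0) /\
  forall I : {vspace L}, (forall x y : L, y \in I -> [lie x, y] \in I) ->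
    I = 0%VS \/ I = fullv.

Definition ad_diagonalizable (K : fieldType) (L : vectLieType K) (x : L) : Prop :=
  exists2 b : seq L, basis_of fullv b &
    forall v, v \in b -> exists a : K, [lie x, v] = a *: v.

(* The usual definition of a Cartan subalgebra of a complex semisimple Lie
   algebra (e.g. in Hall's textbook); it is not meant for other algebras. *)
Record cartan (K : fieldType) (L : vectLieType K) (h : {vspace L}) : Prop := {
  cartan_abelian : forall x y : L, x \in h -> y \in h -> [lie x, y] = 0;
  cartan_self_centralizing :
    forall x : L, (forall y, y \in h -> [lie y, x] = 0) -> x \in h;
  cartan_diagonalizable : forall x : L, x \in h -> ad_diagonalizable x
}.


Section FiniteRoots.
Variables (K : fieldType) (L : vectLieType K) (h : {vspace L}).

Definition hdual := 'Hom(subvs_of h, K^o).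
Implicit Types (a b : hdual).

Definition root_space a : set L :=
  [set x | forall H : subvs_of h, [lie vsval H, x] = (a H : K) *: x].

Definition fin_roots : set hdual :=
  [set a | a <> 0 /\ exists2 x, root_space a x & x <> 0].

Definition root_vectors (x : hdual -> L) : Prop :=
  forall a, fin_roots a -> root_space a (x a) /\ x a <> 0.

(* The coroot of a root a is the unique element of [g_a, g_-a] on which a takes
   the value 2; [xget] selects it. *)
Definition coroot a : subvs_of h :=
  xget 0 [set H | a H = 2%:R /\ exists x y,
    [/\ root_space a x, root_space (- a) y & vsval H = [lie x, y]]].

Definition reflection a b : hdual := b - (b (coroot a) : K) *: a.

(* The empty set is allowed. In rank at least 2 this has no influence on the
   maximal proper closed subroot systems, since every {a, -a} is a nonempty
   proper one. In rank 1 the empty set is the maximal proper closed subroot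
   system; the corresponding subalgebra h + sum_(r != 0) h t^r of affine sl_2
   is indeed a maximal symmetric regular subalgebra. *)
Definition closed_subroot_system (Psi : set hdual) : Prop :=
  [/\ Psi `<=` fin_roots,
      forall a b, Psi a -> Psi b -> Psi (reflection a b) &
      forall a b, Psi a -> Psi b -> fin_roots (a + b) -> Psi (a + b)].

Definition proper_closed_subroot_system (Psi : set hdual) : Prop :=
  closed_subroot_system Psi /\ Psi <> fin_roots.

Definition maximal_closed_subroot_system (Psi : set hdual) : Prop :=
  proper_closed_subroot_system Psi /\
  forall Phi, proper_closed_subroot_system Phi -> Psi `<=` Phi -> Phi = Psi.

Definition root_lattice : set hdual :=
  smallest [set Q : set hdual | Q 0 /\ forall a b, Q a -> Q b -> Q (a - b)]
    fin_roots.

(* Only the values of f on the roots matter. *)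
Definition Zlinear_on_roots (f : hdual -> int) : Prop :=
  exists F : hdual -> int,
    (forall a b, root_lattice a -> root_lattice b -> F (a + b) = F a + F b) /\
    forall a, fin_roots a -> f a = F a.

End FiniteRoots.

(* The loop algebra L[t, t^-1]: finitely supported functions from int to L,
   where x stands for the sum of the x n (x) t^n. *)

Section Loop.
Variables (K : fieldType) (L : lmodType K).

Definition fin_supp : pred (int -> L) :=
  fun x => `[< finite_set [set n | x n != 0] >].

Record loop := Loop { loop_fun :> int -> L; _ : fin_supp loop_fun }.

HB.instance Definition _ := [isSub for loop_fun].
HB.instance Definition _ := [Choice of loop by <:].

Lemma fin_supp_submod : submod_closed fin_supp.
Proof.
split=> [|a x y /asboolP xf /asboolP yf]; apply/asboolP.
  by apply: (sub_finite_set _ (finite_set0 int)) => n /=; rewrite eqxx.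
apply: (sub_finite_set _ (_ : finite_set
    ([set n | x n != 0] `|` [set n | y n != 0]))); last by rewrite finite_setU.
move=> n /=; apply: contraNP => /not_orP[/negP + /negP].
by rewrite !negbK => /eqP xn0 /eqP yn0; rewrite !fctE xn0 yn0 scaler0 addr0.
Qed.

HB.instance Definition _ := GRing.SubChoice_isSubLmodule.Build K _ fin_supp loop
  (GRing.submod_closed_semi fin_supp_submod).

End Loop.

Section LoopTheory.
Variables (K : fieldType) (L : lmodType K).
Implicit Types (x y : loop L) (v : L) (r n : int) (a : K).

Lemma loopP x y : (forall n, x n = y n) -> x = y.
Proof. by move=> xy; apply: val_inj; apply/funext. Qed.

Lemma loop_add x y n : (x + y) n = x n + y n. Proof. by []. Qed.
Lemma loop_scale a x n : (a *: x) n = a *: x n. Proof. by []. Qed.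
Lemma loop_zero n : (0 : loop L) n = 0. Proof. by []. Qed.

Definition loop_supp x : {fset int} := fset_set [set n | x n != 0].

Lemma loop_suppP x n : n \notin loop_supp x -> x n = 0.
Proof.
have /asboolP fx := valP x.
by rewrite in_fset_set// notin_setE /= => /negP; rewrite negbK => /eqP.
Qed.

Lemma fin_supp_sub (A : {fset int}) (f : int -> L) :
  (forall n, n \notin A -> f n = 0) -> fin_supp f.
Proof.
move=> Af; apply/asboolP; apply: (sub_finite_set _ (finite_fset A)) => n /=.
by apply: contraNT => /Af ->.
Qed.

Lemma tens_subproof v r : fin_supp (fun n => if n == r then v else 0).
Proof.
by apply: (@fin_supp_sub [fset r]%fset) => n; rewrite in_fset1 => /negbTE ->.
Qed.

Definition tens v r : loop L := Loop (tens_subproof v r).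

Lemma tensE v r n : tens v r n = if n == r then v else 0. Proof. by []. Qed.

Lemma loop_sumE (I : Type) (s : seq I) (F : I -> loop L) n :
  (\sum_(i <- s) F i) n = \sum_(i <- s) F i n.
Proof. by elim/big_rec2: _ => // i u w _ <-. Qed.

Lemma loop_decomp x : x = \sum_(m <- loop_supp x) tens (x m) m.
Proof.
apply: loopP => n; rewrite loop_sumE.
have [nx|/[dup] nx /loop_suppP->] := boolP (n \in loop_supp x).
  rewrite (bigD1_seq n)//= ?fset_uniq// eqxx big1 ?addr0// => m /negbTE.
  by rewrite eq_sym => ->.
rewrite big1_seq// => m /= mx; case: eqP => // nm.
by rewrite nm mx in nx.
Qed.

Lemma loop_ind (P : loop L -> Prop) : P 0 ->
  (forall x y, P x -> P y -> P (x + y)) -> (forall v r, P (tens v r)) ->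
  forall x, P x.
Proof.
move=> P0 PD PT x; rewrite (loop_decomp x).
by apply: (big_ind P) => // m _; apply: PT.
Qed.

Lemma fsum_supp (M : nmodType) x (F : int -> M) :
  (forall m, x m = 0 -> F m = 0) ->
  forall A : {fset int}, (loop_supp x `<=` A)%fset ->
  \sum_(m \in [set: int]) F m = \sum_(m <- A) F m.
Proof.
move=> F0 A /fsubsetP sA; apply: fsbigTE => m mA; apply/F0/loop_suppP.
by apply: contra mA => /sA.
Qed.

Lemma fsum_linear (M : lmodType K) (F : L -> int -> M) a x y :
  (forall m, linear (F^~ m)) ->
  \sum_(m \in [set: int]) F ((a *: x + y) m) m =
  a *: \sum_(m \in [set: int]) F (x m) m + \sum_(m \in [set: int]) F (y m) m.
Proof.
move=> lF.
have F0 m : F 0 m = 0.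
  have := lF m 1 0 0; rewrite !scale1r addr0 => /esym/eqP.
  by rewrite -subr_eq0 addrK => /eqP.
pose A := (loop_supp x `|` loop_supp y `|` loop_supp (a *: x + y)%R)%fset.
rewrite (@fsum_supp _ (a *: x + y) _ _ A) ?fsubsetUr//; last by move=> m ->.
rewrite (@fsum_supp _ x _ _ A); last 2 first.
- by move=> m ->.
- by rewrite /A -fsetUA fsubsetUl.
rewrite (@fsum_supp _ y _ _ A); last 2 first.
- by move=> m ->.
- by rewrite /A fsetUAC fsubsetUr.
by rewrite scaler_sumr -big_split; apply: eq_bigr => m _; apply: lF.
Qed.

Lemma fsum_tens (M : nmodType) (F : L -> int -> M) v r :
  (forall m, F 0 m = 0) ->
  \sum_(m \in [set: int]) F (tens v r m) m = F v r.
Proof.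
move=> F0; rewrite (@fsbigTE _ _ _ _ [fset r]%fset) ?big_seq_fset1 ?tensE ?eqxx//.
by move=> m; rewrite in_fset1 tensE => /negbTE ->.
Qed.

Lemma deg_der_subproof x : fin_supp (fun n => n%:~R *: x n : L).
Proof.
by apply: (@fin_supp_sub (loop_supp x)) => n /loop_suppP ->; rewrite scaler0.
Qed.

(* t d/dt *)
Definition deg_der x : loop L := Loop (deg_der_subproof x).

Lemma deg_der_linear : linear deg_der.
Proof.
move=> a x y; apply: loopP => n; rewrite [RHS]loop_add loop_scale.
rewrite -[LHS]/(n%:~R *: (a *: x n + y n)) -[in RHS]/(n%:~R *: x n).
by rewrite scalerDr !scalerA mulrC.
Qed.

Lemma deg_derD x y : deg_der (x + y) = deg_der x + deg_der y.
Proof. by have := deg_der_linear 1 x y; rewrite !scale1r. Qed.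

Lemma deg_der0 : deg_der 0 = 0.
Proof. by apply: (addrI (deg_der 0)); rewrite -deg_derD !addr0. Qed.

Lemma deg_derZ a x : deg_der (a *: x) = a *: deg_der x.
Proof. by have := deg_der_linear a x 0; rewrite deg_der0 !addr0. Qed.

Lemma deg_derN x : deg_der (- x) = - deg_der x.
Proof. by rewrite -scaleN1r deg_derZ scaleN1r. Qed.

Lemma deg_der_tens v r : deg_der (tens v r) = tens (r%:~R *: v) r.
Proof.
by apply: loopP => n; rewrite /=; case: eqP => [->//|]; rewrite scaler0.
Qed.

End LoopTheory.

Section LoopLie.
Variables (K : fieldType) (L : lieType K).
Implicit Types (x y z : loop L) (u v w : L) (r s n : int) (a : K).

Lemma loop_lie_subproof x y :
  fin_supp (fun n => \sum_(m \in [set: int]) [lie x m, y (n - m)]).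
Proof.
pose A : {fset int} := seq_fset tt
  [seq i + j | i <- loop_supp x, j <- loop_supp y].
apply: (@fin_supp_sub _ _ A).
move=> n nA; apply: fsbig1 => m _.
have [mx|/loop_suppP->] := boolP (m \in loop_supp x); last by rewrite lie0l.
have [my|/loop_suppP->] := boolP (n - m \in loop_supp y); last by rewrite lie0r.
case/negP: nA; rewrite seq_fsetE; apply/allpairsP; exists (m, n - m).
by split=> //=; rewrite subrKC.
Qed.

(* (x t^m, y t^n) |-> [x, y] t^(m + n) *)
Definition loop_lie x y : loop L := Loop (loop_lie_subproof x y).

Lemma loop_lie_linearl y : linear (loop_lie^~ y).
Proof.
move=> a x x'; apply: loopP => n /=.
by apply: (fsum_linear (F := fun v m => [lie v, y (n - m)])) => m; apply: lie_linearl.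
Qed.

Lemma loop_lieE_r x y n :
  loop_lie x y n = \sum_(m \in [set: int]) [lie x (n - m), y m].
Proof.
rewrite /= (reindex_fsbigT (fun m => n - m)) /=; last first.
  exists (fun m => n - m) => m; exact: subKr.
apply: eq_fsbigr => m _ /=; by rewrite subKr.
Qed.

Lemma loop_lie_linearr x : linear (loop_lie x).
Proof.
move=> a y y'; apply: loopP => n; rewrite loop_add loop_scale !loop_lieE_r.
by apply: (fsum_linear (F := fun v m => [lie x (n - m), v])) => m; apply: lie_linearr.
Qed.

Lemma loop_lie_tens u r v s :
  loop_lie (tens u r) (tens v s) = tens [lie u, v] (r + s).
Proof.
apply: loopP => n /=.
rewrite (fsum_tens (F := fun w m => [lie w, tens v s (n - m)])); last first.
  by move=> m; rewrite lie0l.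
by rewrite !tensE subr_eq addrC; case: eqP => // _; rewrite lie0r.
Qed.

Lemma loop_lieC x y : loop_lie x y = - loop_lie y x.
Proof.
apply: loopP => n; rewrite loop_lieE_r.
rewrite -[RHS]/(- \sum_(m \in [set: int]) [lie y m, x (n - m)]).
rewrite !(@fsum_supp _ _ _ y _ _ (loop_supp y)) ?fsubset_refl//.
- by rewrite -sumrN; apply: eq_bigr => m _; apply: lieC.
- by move=> m ->; rewrite lie0l.
- by move=> m ->; rewrite lie0r.
Qed.

Lemma loop_lieDl x y z : loop_lie (x + y) z = loop_lie x z + loop_lie y z.
Proof. by have /= := loop_lie_linearl z 1 x y; rewrite !scale1r. Qed.

Lemma loop_lieDr x y z : loop_lie x (y + z) = loop_lie x y + loop_lie x z.
Proof. by have /= := loop_lie_linearr x 1 y z; rewrite !scale1r. Qed.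

Lemma loop_liexx x : loop_lie x x = 0.
Proof.
elim/loop_ind: x => [|x y xx yy|v r].
- by apply: (addrI (loop_lie 0 0)); rewrite -loop_lieDl !addr0.
- by rewrite loop_lieDl !loop_lieDr xx yy add0r addr0 loop_lieC addNr.
- rewrite loop_lie_tens liexx.
  by apply: loopP => n; rewrite tensE if_same.
Qed.

Lemma loop_lie0r x : loop_lie x 0 = 0.
Proof. by apply: (addrI (loop_lie x 0)); rewrite -loop_lieDr !addr0. Qed.

Lemma loop_lie0l x : loop_lie 0 x = 0.
Proof. by apply: (addrI (loop_lie 0 x)); rewrite -loop_lieDl !addr0. Qed.

Lemma tensD v w r : tens (v + w) r = tens v r + tens w r.
Proof.
apply: loopP => n; rewrite loop_add !tensE.
by case: eqP => // _; rewrite addr0.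
Qed.

Lemma tens0 r : tens (0 : L) r = 0.
Proof. by apply: loopP => n; rewrite tensE if_same. Qed.

Lemma loop_jacobi x y z : loop_lie x (loop_lie y z) +
  loop_lie y (loop_lie z x) + loop_lie z (loop_lie x y) = 0.
Proof.
have addJ (a b c a' b' c' : loop L) :
    a + b + c = 0 -> a' + b' + c' = 0 -> (a + a') + (b + b') + (c + c') = 0.
  by move=> e e'; rewrite (addrACA a a') (addrACA (a + b)) e e' addr0.
elim/loop_ind: x => [|x x' hx hx'|u r].
- by rewrite !(loop_lie0l, loop_lie0r) !addr0.
- by rewrite !(loop_lieDl, loop_lieDr); apply: addJ.
elim/loop_ind: y => [|y y' hy hy'|v s].
- by rewrite !(loop_lie0l, loop_lie0r) !addr0.
- by rewrite !(loop_lieDl, loop_lieDr); apply: addJ.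
elim/loop_ind: z => [|z z' hz hz'|w t].
- by rewrite !(loop_lie0l, loop_lie0r) !addr0.
- by rewrite !(loop_lieDl, loop_lieDr); apply: addJ.
rewrite !loop_lie_tens (addrC s (t + r)) -(addrA t) (addrA r) -(addrA r).
rewrite (addrCA t) (addrC t s) -!tensD lie_jacobi.
exact: tens0.
Qed.

HB.instance Definition _ := Lmodule_isLie.Build K (loop L)
  loop_lie_linearl loop_lie_linearr loop_liexx loop_jacobi.

Lemma deg_der_lie x y :
  deg_der [lie x, y] = [lie deg_der x, y] + [lie x, deg_der y].
Proof.
elim/loop_ind: x => [|x x' hx hx'|u r].
- by rewrite !(lie0l, deg_der0) addr0.
- by rewrite !(lieDl, deg_derD) hx hx' addrACA.
elim/loop_ind: y => [|y y' hy hy'|v s].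
- by rewrite !(lie0r, deg_der0) addr0.
- by rewrite !(lieDr, deg_derD) hy hy' addrACA.
rewrite /lie /= !(loop_lie_tens, deg_der_tens) -tensD lieZl lieZr -scalerDl.
by rewrite rmorphD.
Qed.

End LoopLie.


(* The central extension needs a nondegenerate invariant symmetric bilinear form
   on L; it is unique up to a scalar when L is simple, and rescaling it amounts
   to rescaling c, so no normalization is imposed. *)
Record invariant_form (K : fieldType) (L : vectLieType K) := InvariantForm {
  form :> L -> L -> K;
  form_linear : forall y (a : K) x x',
    form (a *: x + x') y = a * form x y + form x' y;
  form_sym : forall x y, form x y = form y x;
  form_invariant : forall x y z, form [lie x, y] z = form x [lie y, z];
  form_nondegenerate : forall x, (forall y, form x y = 0) -> x = 0
}.

Section Cocycle.
Variables (K : fieldType) (L : vectLieType K) (B : invariant_form L).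
Implicit Types (x y z : loop L) (u v w : L) (r s n : int) (a : K).

Lemma form0l v : B 0 v = 0.
Proof.
have := form_linear B v 1 0 0; rewrite scale1r addr0 mul1r => /esym/eqP.
by rewrite -subr_eq0 addrK => /eqP.
Qed.

(* (x t^m, y t^n) |-> m (x | y) if m + n = 0, and 0 otherwise *)
Definition cocycle x y : K :=
  \sum_(m \in [set: int]) m%:~R * B (x m) (y (- m)).

Lemma cocycle_linearl y : linear (cocycle^~ y : loop L -> K^o).
Proof.
move=> a x x'.
apply: (fsum_linear (M := K^o) (F := fun v m => m%:~R * B v (y (- m)))) => m b v w.
by rewrite form_linear mulrDr mulrCA.
Qed.

Lemma cocycle_alt x y : cocycle x y = - cocycle y x.
Proof.
rewrite /cocycle (@fsum_supp _ _ _ x _ _ (loop_supp x)); last 2 first.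
- by move=> m ->; rewrite form0l mulr0.
- exact: fsubset_refl.
rewrite (reindex_fsbigT (fun m => - m)) /=; last first.
  by exists (fun m => - m) => m; exact: opprK.
rewrite (@fsum_supp _ _ _ x _ _ (loop_supp x)); last 2 first.
- by move=> m xm; rewrite opprK xm form_sym form0l mulr0.
- exact: fsubset_refl.
rewrite -sumrN; apply: eq_bigr => m _.
by rewrite opprK form_sym rmorphN /= mulNr opprK.
Qed.

Lemma cocycle_linearr x : linear (cocycle x : loop L -> K^o).
Proof.
move=> a y y'; rewrite ![cocycle x _]cocycle_alt.
have /= -> := cocycle_linearl x a y y'.
by rewrite opprD scalerN.
Qed.

Lemma cocycle_tens u r v s :
  cocycle (tens u r) (tens v s) = if r + s == 0 then r%:~R * B u v else 0.
Proof.
rewrite /cocycle (fsum_tens (F := fun w m => m%:~R * B w (tens v s (- m)))).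
  rewrite tensE eq_sym -[s == _](inj_eq (addrI r)) subrr.
  by case: eqP => // _; rewrite form_sym form0l mulr0.
by move=> m; rewrite form0l mulr0.
Qed.

Lemma cocycleDl x y z : cocycle (x + y) z = cocycle x z + cocycle y z.
Proof. by have /= := cocycle_linearl z 1 x y; rewrite !scale1r. Qed.

Lemma cocycleDr x y z : cocycle x (y + z) = cocycle x y + cocycle x z.
Proof. by have /= := cocycle_linearr x 1 y z; rewrite !scale1r. Qed.

Lemma cocycle0l x : cocycle 0 x = 0.
Proof. by apply: (addrI (cocycle 0 x)); rewrite -cocycleDl !addr0. Qed.

Lemma cocycle0r x : cocycle x 0 = 0.
Proof. by apply: (addrI (cocycle x 0)); rewrite -cocycleDr !addr0. Qed.

Lemma cocycleZr a x y : cocycle x (a *: y) = a * cocycle x y.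
Proof.
by have /= := cocycle_linearr x a y 0; rewrite cocycle0r !addr0.
Qed.

Lemma cocycleNr x y : cocycle x (- y) = - cocycle x y.
Proof. by rewrite -scaleN1r cocycleZr mulN1r. Qed.

Lemma cocyclexx x : cocycle x x = 0.
Proof.
elim/loop_ind: x => [|x y xx yy|v r]; first exact: cocycle0l.
  by rewrite cocycleDl !cocycleDr xx yy add0r addr0 cocycle_alt addNr.
rewrite cocycle_tens; case: eqP => // rr.
suff -> : r = 0 by rewrite mul0r.
by have := mulrn_eq0 r 2; rewrite mulr2n rr eqxx => /esym/eqP.
Qed.

Lemma cocycle_jacobi x y z : cocycle x [lie y, z] +
  cocycle y [lie z, x] + cocycle z [lie x, y] = 0.
Proof.
have addJ (a b c a' b' c' : K) :
    a + b + c = 0 -> a' + b' + c' = 0 -> (a + a') + (b + b') + (c + c') = 0.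
  by move=> e e'; rewrite (addrACA a a') (addrACA (a + b)) e e' addr0.
elim/loop_ind: x => [|x x' hx hx'|u r].
- by rewrite !(lie0l, lie0r, cocycle0l, cocycle0r) !addr0.
- by rewrite !(lieDl, lieDr, cocycleDl, cocycleDr); apply: addJ.
elim/loop_ind: y => [|y y' hy hy'|v s].
- by rewrite !(lie0l, lie0r, cocycle0l, cocycle0r) !addr0.
- by rewrite !(lieDl, lieDr, cocycleDl, cocycleDr); apply: addJ.
elim/loop_ind: z => [|z z' hz hz'|w t].
- by rewrite !(lie0l, lie0r, cocycle0l, cocycle0r) !addr0.
- by rewrite !(lieDl, lieDr, cocycleDl, cocycleDr); apply: addJ.
rewrite /lie /= !loop_lie_tens !cocycle_tens.
have -> : s + (t + r) = r + (s + t) by rewrite [RHS]addrC addrA.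
have -> : t + (r + s) = r + (s + t) by rewrite addrC addrA.
case: eqP => [e|_]; last by rewrite !addr0.
have -> : B v [lie w, u] = B u [lie v, w].
  by rewrite -form_invariant form_sym.
have -> : B w [lie u, v] = B u [lie v, w].
  by rewrite form_sym form_invariant.
by rewrite -!mulrDl -!rmorphD /= -addrA e mul0r.
Qed.

Lemma cocycle_deg_der x y : cocycle (deg_der x) y + cocycle x (deg_der y) = 0.
Proof.
elim/loop_ind: x => [|x x' hx hx'|u r].
- by rewrite !(deg_der0, cocycle0l) addr0.
- by rewrite deg_derD !cocycleDl addrACA hx hx' addr0.
elim/loop_ind: y => [|y y' hy hy'|v s].
- by rewrite !(deg_der0, cocycle0r) addr0.
- by rewrite deg_derD !cocycleDr addrACA hy hy' addr0.
rewrite !deg_der_tens !cocycle_tens; case: eqP => [e|_]; last by rewrite addr0.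
have formZ a w w' : B (a *: w) w' = a * B w w'.
  by have := form_linear B w' a w 0; rewrite form0l !addr0.
rewrite formZ [B u (_ *: _)]form_sym formZ [B v u]form_sym -mulrDr -mulrDl -rmorphD /= e.
by rewrite mul0r mulr0.
Qed.

End Cocycle.

(* L[t, t^-1] + K c + K d; the triple (x, a, b) stands for x + a c + b d *)
Definition affine (K : fieldType) (L : vectLieType K) (B : invariant_form L) : Type :=
  (loop L * K^o * K^o)%type.

Section Affine.
Variables (K : fieldType) (L : vectLieType K) (B : invariant_form L).

HB.instance Definition _ :=
  GRing.Lmodule.copy (affine B) (loop L * K^o * K^o)%type.

Implicit Types (u v w : affine B) (x y z : loop L).

(* [d, x t^n] = n x t^n and c is central *)
Definition affine_lie u v : affine B :=
  ([lie u.1.1, v.1.1] + (u.2 : K) *: deg_der v.1.1 - (v.2 : K) *: deg_der u.1.1,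
   cocycle B u.1.1 v.1.1, 0).

Lemma affine_lie_linearl v : linear (affine_lie^~ v).
Proof.
move=> a u u'; congr (_, _, _).
- rewrite /= lieDl lieZl deg_der_linear scalerDl !scalerDr scalerN !scalerA.
  rewrite (mulrC (v.2 : K)) opprD [RHS]addrACA; congr (_ + _).
  exact: addrACA.
- exact: cocycle_linearl.
- by rewrite /= scaler0 addr0.
Qed.

Lemma affine_lieC u v : affine_lie u v = - affine_lie v u.
Proof.
congr (_, _, _).
- by rewrite /= !opprD opprK -lieC addrAC.
- exact: (cocycle_alt B u.1.1 v.1.1).
- by rewrite oppr0.
Qed.

Lemma affine_lie_linearr u : linear (affine_lie u).
Proof.
move=> a v v'; rewrite ![affine_lie u _]affine_lieC affine_lie_linearl.
by rewrite opprD scalerN.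
Qed.

Lemma affine_liexx u : affine_lie u u = 0.
Proof.
by rewrite /affine_lie liexx add0r subrr cocyclexx.
Qed.

Fact affine_jacobi_aux (V : zmodType)
    (X1 X2 X3 P1 P2 P3 P4 P5 P6 Q1 Q2 Q3 : V) :
  X1 + P1 - P2 + (- P3 + P4 + Q1 - Q2) + (X2 + P5 - P4 + (- P1 + P6 + Q3 - Q1))
    + (X3 + P3 - P6 + (- P5 + P2 + Q2 - Q3)) = X1 + X2 + X3.
Proof.
rewrite !addrA [LHS](ACl (1*8*15*2*11*16*4*19*3*5*10*6*14*9*18*12*17*20*7*13*21)).
by rewrite /= !addrK.
Qed.

Lemma affine_jacobi u v w : affine_lie u (affine_lie v w) +
  affine_lie v (affine_lie w u) + affine_lie w (affine_lie u v) = 0.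
Proof.
case: u v w => [[x p] a] [[y q] b] [[z r] c]; congr (_, _, _); rewrite /=.
- rewrite !scale0r !subr0.
  have T (x1 x2 x3 : loop L) (a1 a2 a3 : K) :
      [lie x1, [lie x2, x3] + a2 *: deg_der x3 - a3 *: deg_der x2] +
      a1 *: deg_der ([lie x2, x3] + a2 *: deg_der x3 - a3 *: deg_der x2) =
      [lie x1, [lie x2, x3]] + a2 *: [lie x1, deg_der x3]
      - a3 *: [lie x1, deg_der x2] +
      (- (a1 *: [lie x3, deg_der x2]) + a1 *: [lie x2, deg_der x3]
       + (a1 * a2) *: deg_der (deg_der x3) - (a1 * a3) *: deg_der (deg_der x2)).
    rewrite !(lieDr, lieNr, deg_derD, deg_derN, deg_derZ, lieZr) deg_der_lie.
    rewrite [ [lie deg_der x2, x3] ]lieC.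
    by rewrite !scalerDr !scalerN !scalerA.
  rewrite (T x y z a b c) (T y z x b c a) (T z x y c a b).
  rewrite [b * a]mulrC [c * a]mulrC [c * b]mulrC.
  rewrite affine_jacobi_aux.
  exact: loop_jacobi.
- rewrite !cocycleDr !cocycleNr !cocycleZr.
  have C (x1 x2 : loop L) : cocycle B x2 (deg_der x1) = cocycle B x1 (deg_der x2).
    apply/eqP; rewrite -subr_eq0 [cocycle B x2 _]cocycle_alt -opprD oppr_eq0.
    by rewrite cocycle_deg_der.
  rewrite (C x y) (C x z) (C y z) -(cocycle_jacobi B x y z).
  rewrite !addrA (ACl (1*4*7*2*9*5*3*8*6)) /=.
  by rewrite !addrK.
- by rewrite !addr0.
Qed.

HB.instance Definition _ := Lmodule_isLie.Build K (affine B)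
  affine_lie_linearl affine_lie_linearr affine_liexx affine_jacobi.

End Affine.

Section Regular.
Variables (K : fieldType) (L : vectLieType K) (B : invariant_form L).
Variable h : {vspace L}.

Definition aff_tens (x : L) (r : int) : affine B := (tens x r, 0, 0).
Definition aff_c : affine B := (0, 1, 0).
Definition aff_d : affine B := (0, 0, 1).

(* The Cartan subalgebra h + K c + K d, and its embedding in the affine
   algebra. *)
Definition aff_cartan := (subvs_of h * K^o * K^o)%type.

Definition aff_cartan_val (H : aff_cartan) : affine B :=
  aff_tens (vsval H.1.1) 0 + (H.1.2 : K) *: aff_c + (H.2 : K) *: aff_d.

Definition aff_hdual := 'Hom(aff_cartan, K^o).
Implicit Types (l : aff_hdual) (s t : set (affine B)).

(* delta is the d-coordinate, and a root of L is extended by 0 on c and d. *)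
Definition delta : aff_hdual := linfun (snd : aff_cartan -> K^o).
Definition extend (a : hdual h) : aff_hdual :=
  (a \o linfun (fst : (subvs_of h * K^o)%type -> subvs_of h)
     \o linfun (fst : aff_cartan -> (subvs_of h * K^o)%type))%VF.

Definition real_roots : set aff_hdual :=
  [set l | exists a (r : int), fin_roots a /\ l = extend a + delta *~ r].
Definition imaginary_roots : set aff_hdual :=
  [set l | exists r : int, r <> 0 /\ l = delta *~ r].
Definition aff_roots : set aff_hdual := real_roots `|` imaginary_roots.

Lemma deltaE (H : aff_cartan) : delta H = H.2.
Proof. exact: (lfunE (GRing.Linear.clone _ _ _ _ snd _)). Qed.

Lemma extendE a (H : aff_cartan) : extend a H = a H.1.1.
Proof.
rewrite (comp_lfunE _ _ H) (comp_lfunE a).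
rewrite (lfunE (GRing.Linear.clone _ _ _ _
  (fst : aff_cartan -> (subvs_of h * K^o)%type) _)).
by rewrite (lfunE (GRing.Linear.clone _ _ _ _
  (fst : (subvs_of h * K^o)%type -> subvs_of h) _)).
Qed.

Definition aff_root_space l : set (affine B) :=
  [set u | forall H, [lie aff_cartan_val H, u] = (l H : K) *: u].

Definition lie_subalgebra s : Prop :=
  linear_subspace s /\ forall u v, s u -> s v -> s [lie u, v].

Definition regular_subalgebra s : Prop :=
  lie_subalgebra s /\ forall H u, s u -> s [lie aff_cartan_val H, u].

Definition roots_of s : set aff_hdual :=
  [set l | aff_roots l /\ exists2 u, aff_root_space l u /\ s u & u <> 0].

Definition symmetric_subset s : Prop := roots_of s = [set - l | l in roots_of s].

Definition proper_symmetric_regular s : Prop :=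
  [/\ regular_subalgebra s, symmetric_subset s & s <> setT].

Definition maximal_symmetric_regular s : Prop :=
  proper_symmetric_regular s /\
  forall t, proper_symmetric_regular t -> s `<=` t -> t = s.

Variable x : hdual h -> L.

(* The sums below are written as linear spans of their generators; they are
   direct because the listed subspaces lie in distinct root spaces, or in
   the Cartan subalgebra. *)
Definition subalgebra_of_subroot_system (Psi : set (hdual h)) : set (affine B) :=
  lspan (range aff_cartan_val `|`
    [set u | exists a (r : int), Psi a /\ u = aff_tens (x a) r] `|`
    [set u | exists (H : subvs_of h) (r : int), r <> 0 /\ u = aff_tens (vsval H) r]).

Definition subalgebra_of_function (f : hdual h -> int) (k : nat) :
    set (affine B) :=
  lspan ([set u | exists a (r : int), fin_roots a /\
                    u = aff_tens (x a) (f a + k%:Z * r)] `|`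
    [set u | exists (H : subvs_of h) (r : int), u = aff_tens (vsval H) (k%:Z * r)] `|`
    [set aff_c] `|` [set aff_d]).

End Regular.
Arguments subalgebra_of_subroot_system {K L} B {h} x Psi _.
Arguments subalgebra_of_function {K L} B {h} x f k _.

(* Main.v *)
From HB Require Import structures.
Require Import Defs.
From mathcomp Require Import all_boot all_order all_algebra finmap.
From mathcomp Require Import boolp classical_sets functions cardinality fsbigop.
From mathcomp Require Import reals complex ring zify.

Set Implicit Arguments.
Unset Strict Implicit.
Unset Printing Implicit Defensive.

Import Order.TTheory GRing.Theory Num.Theory.

Local Open Scope classical_set_scope.
Local Open Scope ring_scope.

(* Write h for the Cartan subalgebra of the affine algebra g.  A maximal s with
   s + h <> g contains h; if s + h = g, then s contains all root spaces, hence
   [g, g].  An s containing h is recorded, up to its imaginary root spaces, by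
   the sets Z_a = {r : x_a t^r in s}, a running over the finite roots.
   If some Z_a is empty, the finite roots occurring in s form a proper closed
   subroot system.  Otherwise bracketing x_a t^r, x_-a t^-m and x_b t^n shows
   that Z_b is stable under the differences of Z_a as soon as b(h_a) <> 0;
   since the roots are connected, all Z_a are cosets of one k Z.  As
   Z_a + Z_b lies in Z_(a+b), choosing an element of Z_a for every simple root a
   and extending linearly yields f with f a in Z_a for every root a, and k can be
   replaced by any of its prime divisors.  The invariant form supplies coroots
   without Killing's criterion, and linear independence of the simple roots comes
   from the positivity of the trace form on the rational span of the coroots. *)

(** Real root spaces are lines, so a subalgebra stable under h contains each of them entirely or
    meets it in 0. A space h t^r with r <> 0 has the dimension of h and may be contained only in
    part. This is why no exact description of [s] is attempted: [s] is enclosed in a proper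
    subalgebra of one of the listed shapes, and maximality turns the inclusion into an equality. For
    the enclosure, the imaginary degrees must be multiples of k; they are, because H t^r with H <> 0
    shifts Z_a by r for any root a with a(H) <> 0. The number k can be 0, namely when every Z_a is a
    single degree, and then any prime serves. It cannot be 1, since [s] would contain all real root
    vectors and h, hence be g. In the converse direction a larger proper subalgebra contains h and
    is analysed by the same sets Z_a. *)

(** * Linear subspaces, subgroups of the integers and ideals *)

Section LinearSubspace.
Variables (K : fieldType) (V : lmodType K) (T : set V).
Hypothesis linT : linear_subspace T.

Lemma subspace0 : T 0. Proof. by case: linT. Qed.

Lemma subspaceD u v : T u -> T v -> T (u + v).
Proof. by case: linT => _ /(_ 1 u v); rewrite scale1r. Qed.

Lemma subspaceZ a u : T u -> T (a *: u).
Proof. by case: linT => T0 /(_ a u 0) + Tu; rewrite addr0; apply. Qed.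

Lemma subspaceB u v : T u -> T v -> T (u - v).
Proof. by move=> Tu Tv; rewrite -scaleN1r; apply/subspaceD/subspaceZ. Qed.

Lemma subspaceZK a u : a != 0 -> T (a *: u) -> T u.
Proof. by move=> a0 /(subspaceZ a^-1); rewrite scalerA mulVf// scale1r. Qed.

Lemma subspace_sum (I : eqType) (s : seq I) (P : pred I) (F : I -> V) :
  (forall i, i \in s -> P i -> T (F i)) -> T (\sum_(i <- s | P i) F i).
Proof.
move=> TF; rewrite big_seq_cond; apply: big_ind => [||i /andP[]].
- exact: subspace0.
- exact: subspaceD.
- exact: TF.
Qed.

(* Apply [A i - wt j0 i] to kill the component of index [j0] and induct. *)
Lemma eigen_components (I : Type) (A : I -> V -> V) (J : eqType) (s : seq J)
    (wt : J -> I -> K) (u : J -> V) :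
  (forall i, linear (A i)) -> (forall i v, T v -> T (A i v)) ->
  (forall j i, A i (u j) = wt j i *: u j) ->
  uniq s -> {in s &, forall j j', wt j =1 wt j' -> j = j'} ->
  T (\sum_(j <- s) u j) -> forall j, j \in s -> T (u j).
Proof.
move=> linA stA; elim: s u => [//|j0 s IHs] u Au /= /andP[j0s us] wtI.
rewrite big_cons => Tu.
have Ts j : j \in s -> T (u j).
  move=> js; have [i /eqP wti] : exists i, wt j i <> wt j0 i.
    apply: contrapT => /forallNP /(_ _)/contrapT e.
    by move: j0s; rewrite -(wtI j j0 _ _ e) ?js// ?inE ?js ?orbT// eqxx.
  apply: (@subspaceZK (wt j i - wt j0 i)); first by rewrite subr_eq0.
  apply: (IHs (fun j => (wt j i - wt j0 i) *: u j)) => // [j' i'|j1 j2 j1s j2s|].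
  - have A0 : A i' 0 = 0.
      by apply: (addrI (A i' 0)); have := linA i' 1 0 0; rewrite !scale1r !addr0.
    have := linA i' (wt j' i - wt j0 i) (u j') 0; rewrite A0 !addr0 => ->.
    by rewrite Au !scalerA mulrC.
  - by apply: wtI; rewrite inE ?j1s ?j2s orbT.
  have := subspaceB (stA i _ Tu) (subspaceZ (wt j0 i) Tu).
  have -> : A i (u j0 + \sum_(j <- s) u j) =
      wt j0 i *: u j0 + \sum_(j <- s) wt j i *: u j.
    have AD v w : A i (v + w) = A i v + A i w.
      by have := linA i 1 v w; rewrite !scale1r.
    have A0 : A i 0 = 0 by apply: (addrI (A i 0)); rewrite -AD !addr0.
    rewrite AD Au; congr (_ + _).
    elim: s {IHs j0s us wtI Tu js} => [|j1 s IHs]; first by rewrite !big_nil.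
    by rewrite !big_cons AD Au IHs.
  rewrite scalerDr scaler_sumr opprD addrACA subrr add0r -sumrB.
  by under eq_bigr do rewrite -scalerBl.
move=> j; rewrite inE => /orP[/eqP->|]; last exact: Ts.
rewrite -(addrK (\sum_(j <- s) u j) (u j0)); apply: subspaceB => //.
by apply: subspace_sum => *; apply: Ts.
Qed.

End LinearSubspace.

Lemma subset_lspan (K : fieldType) (V : lmodType K) (A : set V) : A `<=` lspan A.
Proof. exact: sub_gen_smallest. Qed.

Lemma lspan_subspace (K : fieldType) (V : lmodType K) (A : set V) :
  linear_subspace (lspan A).
Proof.
split=> [T [[T0 _] _]//|a u v Tu Tv T TA].
by have [_ TD] := TA.1; apply: TD; [apply: Tu|apply: Tv].
Qed.

Lemma lspan_min (K : fieldType) (V : lmodType K) (A T : set V) :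
  linear_subspace T -> A `<=` T -> lspan A `<=` T.
Proof. by move=> lT AT; apply: smallest_sub. Qed.

Lemma spanning_basis (K : fieldType) (V : vectType K) (X : seq V) :
  <<X>>%VS = fullv -> exists2 b, basis_of fullv b & {subset b <= X}.
Proof.
move=> Xf.
suff [b fb [eb sb]] : exists2 b, free b & <<b>>%VS = <<X>>%VS /\ {subset b <= X}.
  by exists b => //; rewrite /basis_of eb Xf eqxx fb.
elim: X {Xf} => [|v X [b fb [eb sb]]]; first by exists [::]; rewrite ?nil_free.
have [vX|vX] := boolP (v \in <<b>>%VS).
  exists b => //; split; last by move=> y /sb; rewrite inE orbC => ->.
  by rewrite span_cons -eb; apply/esym/addv_idPr.
exists (v :: b); rewrite ?free_cons ?vX//; split.
  by rewrite !span_cons eb.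
by move=> y; rewrite !inE => /orP[->//|/sb->]; rewrite orbT.
Qed.

(** A subspace of maximal dimension among those contained in T must be all of T, as adjoining a
    missing vector would raise the dimension. *)
Lemma vspace_of_subspace (K : fieldType) (V : vectType K) (T : set V) :
  linear_subspace T -> exists U : {vspace V}, forall v, v \in U <-> T v.
Proof.
move=> linT.
pose P n := `[< exists2 U : {vspace V}, (forall v, v \in U -> T v) & \dim U = n >].
have P0 : exists n, P n.
  exists 0; apply/asboolP; exists 0%VS; rewrite ?dimv0// => v.
  by rewrite memv0 => /eqP->; apply: subspace0.
have Pb n : P n -> (n <= \dim (fullv : {vspace V}))%N.
  by move=> /asboolP[U _ <-]; apply: dimvS; apply: subvf.
case: (ex_maxnP P0 Pb) => n /asboolP[U UT dU] nmax; exists U => v; split; first exact: UT.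
move=> Tv; apply: contrapT => /negP vU.
have : P (\dim (U + <[v]>)%VS).
  apply/asboolP; exists (U + <[v]>)%VS => // w /memv_addP[y /UT Ty [z /vlineP[a ->] ->]].
  by apply: subspaceD => //; apply: subspaceZ.
move=> /nmax; rewrite leqNgt -dU => /negP; apply.
rewrite (ltn_leqif (dimv_leqif_sup (addvSl U <[v]>%VS))).
apply: contra vU => /subvP /(_ v); apply.
exact: (subvP (addvSr U _)) (memv_line v).
Qed.

Lemma sum_fibers (I : finType) (J : eqType) (V : nmodType) (p : I -> J) (F : I -> V)
    (s : seq J) : uniq s -> (forall i, p i \in s) ->
  \sum_i F i = \sum_(j <- s) \sum_(i | p i == j) F i.
Proof.
move=> us ps; rewrite (exchange_big_dep xpredT)//=; apply: eq_bigr => i _.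
rewrite big_mkcond (bigD1_seq (p i))//= eqxx big1 ?addr0// => j /negbTE.
by rewrite eq_sym => ->.
Qed.

(** Here [k] is the least positive element, or 0 for the trivial subgroup; the value 0 does occur
    later, for a root with a single degree. *)
Lemma int_subgroup (S : int -> Prop) :
  S 0 -> (forall r m, S r -> S m -> S (r - m)) ->
  exists k : nat, forall r, S r <-> (k%:Z %| r)%Z.
Proof.
move=> S0 SB.
have SN r : S r -> S (- r) by move=> Sr; rewrite -sub0r; apply: SB.
have SD r m : S r -> S m -> S (r + m) by move=> Sr /SN Sm; rewrite -[m]opprK; apply: SB.
have SMn r (m : nat) : S r -> S (r *+ m).
  by move=> Sr; elim: m => [//|m IHm]; rewrite mulrS; apply: SD.
have SM r m : S r -> S (r * m).
  by move=> Sr; rewrite -mulrzz; case: m => m; [exact: SMn|exact/SN/SMn].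
have [ex|/forallNP nex] := pselect (exists m : nat, `[< (0 < m)%N /\ S m%:Z >]); last first.
  exists 0 => r; rewrite dvd0z; split=> [Sr|/eqP->//].
  apply: contrapT => r0; apply: (nex `|r|%N); apply/asboolP; split.
    by rewrite absz_gt0; apply/eqP => r0'; apply: r0; rewrite r0'.
  by rewrite abszE; case: (ger0P r) => _ //; apply: SN.
case: (ex_minnP ex) => k /asboolP[k0 Sk] kmin; exists k => r.
split=> [Sr|/dvdzP[q ->]]; last by rewrite mulrC; apply: SM.
apply/dvdz_mod0P; apply: contrapT => /eqP rk.
have k0' : k%:Z != 0 by lia.
have Srk : S (r %% k)%Z.
  rewrite (_ : (r %% k)%Z = r - k%:Z * (r %/ k)%Z); first by apply: SB => //; apply: SM.
  by rewrite {2}(divz_eq r k) mulrC addrC addKr.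
have rk_ge0 := modz_ge0 r k0'.
have : (k <= `|(r %% k)%Z|)%N.
  by apply: kmin; apply/asboolP; rewrite absz_gt0 gez0_abs.
by rewrite -lez_nat gez0_abs// leNgt ltz_pmod.
Qed.

Section Lie.
Variables (K : fieldType) (L : lieType K).
Implicit Types x y z : L.

Lemma lie_sumr (I : Type) (s : seq I) (P : pred I) (F : I -> L) x :
  [lie x, \sum_(i <- s | P i) F i] = \sum_(i <- s | P i) [lie x, F i].
Proof. by elim/big_rec2: _ => [|i _ u _ <-]; rewrite ?lie0r ?lieDr. Qed.

Lemma lie_suml (I : Type) (s : seq I) (P : pred I) (F : I -> L) x :
  [lie \sum_(i <- s | P i) F i, x] = \sum_(i <- s | P i) [lie F i, x].
Proof. by elim/big_rec2: _ => [|i _ u _ <-]; rewrite ?lie0l ?lieDl. Qed.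

Lemma lie_derivation x y z :
  [lie x, [lie y, z]] = [lie [lie x, y], z] + [lie y, [lie x, z]].
Proof.
have /eqP := lie_jacobi x y z; rewrite -addrA addr_eq0 => /eqP ->.
by rewrite opprD addrC [ [lie z, _] ]lieC opprK [ [lie z, x] ]lieC lieNr opprK.
Qed.

End Lie.

(** Simplicity speaks of ideals of type [{vspace L}], whereas the ideals met below are Prop-valued
    sets such as the centre or a span. *)
Lemma ideal_full (K : fieldType) (L : vectLieType K) (P : set L) :
  simple_lie L -> linear_subspace P -> (forall x y, P y -> P [lie x, y]) ->
  (exists2 y, P y & y <> 0) -> forall y, P y.
Proof.
move=> [_ simL] linP idP [y0 Py0 y0n] y.
have [U UP] := vspace_of_subspace linP.
have [x z /UP /idP Pz|U0|Uf] := simL U.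
- by apply/UP; apply: Pz.
- by case: y0n; apply/eqP; rewrite -memv0 -U0; apply/UP.
- by apply/UP; rewrite Uf memvf.
Qed.

(** * Root spaces and coroots *)

Section WeightBasis.
Variables (K : fieldType) (L : vectLieType K) (h : {vspace L}).
Hypothesis Ch : cartan h.

Let joint (Hs : seq L) (v : L) := forall H, H \in Hs -> exists c : K, [lie H, v] = c *: v.

(** [cartan] makes each element of h diagonalizable by itself; this is simultaneous diagonalization.
    Joint eigenvectors are split along the eigenspaces of one more element, and the pieces remain
    joint eigenvectors because h is abelian. *)
Lemma joint_eigen_sum (Hs : seq L) (v : L) : {subset Hs <= h} ->
  exists2 X : seq L, (forall y, y \in X -> joint Hs y) & v = \sum_(y <- X) y.
Proof.
elim: Hs v => [|H Hs IHs] v HsP.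
  by exists [:: v]; rewrite ?big_seq1// => y _ H; rewrite in_nil.
have Hh : H \in h by apply: HsP; rewrite mem_head.
have [X jX ->] : exists2 X : seq L, (forall y, y \in X -> joint Hs y) & v = \sum_(y <- X) y.
  by apply: IHs => H' H's; apply: HsP; rewrite inE H's orbT.
elim: X jX => [|y X IHX] jX; first by exists [::]; rewrite ?big_nil.
have [Y jY eY] : exists2 Y, (forall y, y \in Y -> joint (H :: Hs) y) &
    \sum_(y <- X) y = \sum_(y <- Y) y.
  by apply: IHX => z zX; apply: jX; rewrite inE zX orbT.
suff [Z jZ eZ] : exists2 Z, (forall y, y \in Z -> joint (H :: Hs) y) & y = \sum_(z <- Z) z.
  exists (Z ++ Y); last by rewrite big_cons big_cat /= eY {1}eZ.
  by move=> z; rewrite mem_cat => /orP[/jZ|/jY].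
have [b bb bP] := cartan_diagonalizable Ch Hh.
have [c cP] : {c : L -> K & forall z, z \in b -> [lie H, z] = c z *: z}.
  apply: (@choice _ _ (fun z c => z \in b -> [lie H, z] = c *: z)) => z.
  have [zb|] := boolP (z \in b); last by exists 0.
  by have [d] := bP z zb; exists d.
have [g gP] : {g : L -> K & forall H', H' \in Hs -> [lie H', y] = g H' *: y}.
  apply: (@choice _ _ (fun H' c => H' \in Hs -> [lie H', y] = c *: y)) => H'.
  have [H'Hs|] := boolP (H' \in Hs); last by exists 0.
  by have [d] := jX y (mem_head _ _) H' H'Hs; exists d.
pose b' := in_tuple b; pose F (i : 'I_(size b)) := coord b' i y *: b'`_i.
pose p (i : 'I_(size b)) := c b'`_i.
have yF : y = \sum_i F i by apply: (coord_basis (X := b')); [apply: bb|apply: memvf].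
pose s := undup (codom p).
have yE : y = \sum_(d <- s) \sum_(i | p i == d) F i.
  rewrite {1}yF; apply: sum_fibers; rewrite ?undup_uniq// => i.
  by rewrite mem_undup codom_f.
pose u d := \sum_(i | p i == d) F i.
have uH d : [lie H, u d] = d *: u d.
  rewrite lie_sumr scaler_sumr; apply: eq_bigr => i /eqP <-.
  by rewrite lieZr cP ?mem_nth// scalerA mulrC -scalerA.
(* The joint eigenspace of [y] is stable under ad H, so it contains the H-components of [y]. *)
pose T := [set v | forall H', H' \in Hs -> [lie H', v] = g H' *: v].
have linT : linear_subspace T.
  split=> [H' _|a z w Tz Tw H' H's]; first by rewrite lie0r scaler0.
  by rewrite lieDr lieZr Tz// Tw// scalerDr !scalerA mulrC.
exists (map u s); last by rewrite big_map.
move=> _ /mapP[d ds ->] H'; rewrite inE => /orP[/eqP->|H's]; first by exists d.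
exists (g H'); move: H' H's; apply: (eigen_components linT (I := unit)
    (A := fun _ => lie H) (wt := fun d _ => d) (s := s)) => //.
- by move=> _; apply: lie_linearr.
- move=> _ z Tz H' H's; rewrite lie_derivation (Tz H' H's) lieZr.
  by rewrite (cartan_abelian Ch (HsP H' _) Hh) ?lie0l ?add0r// inE H's orbT.
- by rewrite undup_uniq.
- by move=> d1 d2 _ _ /(_ tt).
- by rewrite -yE => H' /gP.
Qed.

Lemma joint_root_space v : joint (vbasis h) v -> exists a : hdual h, root_space a v.
Proof.
move=> jv; pose e := vbasis h.
have [c cP] : {c : 'I_(\dim h) -> K & forall i : 'I_(\dim h), [lie e`_i, v] = c i *: v}.
  apply: (@choice _ _ (fun (i : 'I_(\dim h)) c => [lie e`_i, v] = c *: v)) => i.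
  by apply: jv; rewrite mem_nth// size_tuple.
pose f (H : subvs_of h) : K^o := \sum_i coord e i (vsval H) * c i.
have linf : linear f.
  move=> a H H'; rewrite /f scaler_sumr -big_split; apply: eq_bigr => i _ /=.
  by rewrite linearP /= mulrDl -mulrA.
pose F : {linear subvs_of h -> K^o} := HB.pack f (GRing.isLinear.Build _ _ _ _ f linf).
exists (linfun F) => H; rewrite lfunE /= /f scaler_suml.
rewrite {1}(coord_vbasis (subvsP H)) lie_suml; apply: eq_bigr => i _.
by rewrite lieZl cP scalerA.
Qed.

Lemma weight_basis : exists2 b : seq L, basis_of fullv b &
  forall v, v \in b -> exists a : hdual h, root_space a v.
Proof.
have [X XP] : {X : L -> seq L & forall v,
    (forall y, y \in X v -> joint (vbasis h) y) /\ v = \sum_(y <- X v) y}.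
  apply: (@choice _ _ (fun v X => (forall y, y \in X -> joint (vbasis h) y) /\
    v = \sum_(y <- X) y)) => v.
  have [|X jX e] := @joint_eigen_sum (vbasis h) v; last by exists X.
  by move=> H /vbasis_mem.
pose Y := flatten [seq X v | v <- vbasis (fullv : {vspace L})].
have [|b bb bY] := @spanning_basis _ _ Y.
  apply/eqP; rewrite eqEsubv subvf/= -{1}(span_basis (vbasisP fullv)).
  apply/span_subvP => v ve; rewrite (XP v).2 big_seq; apply: memv_suml => y yX.
  by apply: memv_span; apply/flatten_mapP; exists v.
exists b => // v /bY/flatten_mapP[z _ /(XP z).1]; exact: joint_root_space.
Qed.
End WeightBasis.

(** * Weight spaces and the invariant form *)

Section RootTheory.
Variables (K : numFieldType) (L : vectLieType K) (h : {vspace L}).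
Variable B : invariant_form L.
Hypotheses (simL : simple_lie L) (Ch : cartan h).
(** The basis is not indexed by weights: [w] repeats a weight with its multiplicity and is 0 at the
    basis vectors lying in h. *)
Variables (n : nat) (e : n.-tuple L) (w : 'I_n -> hdual h).
Hypotheses (eb : basis_of fullv e) (ew : forall i : 'I_n, root_space (w i) e`_i).
Implicit Types (a b : hdual h) (H : subvs_of h) (u v x y z : L).

Lemma root_space_subspace a : linear_subspace (root_space a).
Proof.
split=> [H|c u v au av H]; first by rewrite lie0r scaler0.
by rewrite lieDr lieZr au av scalerDr !scalerA mulrC.
Qed.

Lemma coord_eb v : v = \sum_i coord e i v *: e`_i.
Proof. exact: coord_basis eb (memvf v). Qed.

Lemma root_space_coord a v i : root_space a v -> coord e i v != 0 -> w i = a.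
Proof.
move=> av vi; apply/lfunP => H.
have := congr1 (coord e i) (av H); rewrite linearZ /= {1}(coord_eb v) lie_sumr.
under eq_bigr do rewrite lieZr ew scalerA.
by rewrite coord_sum_free ?(basis_free eb)// [RHS]mulrC => /(mulfI vi).
Qed.

Definition vproj a v : L := \sum_(i | w i == a) coord e i v *: e`_i.

Lemma vproj_linear a : linear (vproj a).
Proof.
move=> c u v; rewrite /vproj scaler_sumr -big_split; apply: eq_bigr => i _ /=.
by rewrite linearP /= scalerDl scalerA.
Qed.

Lemma vproj0 a : vproj a 0 = 0.
Proof. by rewrite /vproj big1// => i _; rewrite linear0 scale0r. Qed.

Lemma vproj_root a v : root_space a (vproj a v).
Proof.
apply: (subspace_sum (root_space_subspace a)) => i _ /eqP <-.
by apply: (subspaceZ (root_space_subspace _)); apply: ew.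
Qed.

Lemma vproj_id a v : root_space a v -> vproj a v = v.
Proof.
move=> av; rewrite [RHS]coord_eb [RHS](bigID (fun i => w i == a)) /=.
rewrite [X in _ = _ + X]big1 ?addr0// => i; apply: contraNeq => vi.
by apply/eqP/(root_space_coord av); apply: contraNneq vi => ->; rewrite scale0r.
Qed.

Lemma vproj_eq0 a b v : root_space b v -> b <> a -> vproj a v = 0.
Proof.
move=> bv ba; rewrite /vproj big1// => i /eqP wi.
apply/eqP; apply: contrapT => /negP vi; apply: ba.
rewrite -wi; apply/esym/(root_space_coord bv).
by apply: contraNneq vi => ->; rewrite scale0r.
Qed.

Definition wts : seq (hdual h) := undup (codom w).

Lemma vproj_sum v : v = \sum_(a <- wts) vproj a v.
Proof.
rewrite {1}[v]coord_eb; apply: sum_fibers; first exact: undup_uniq.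
by move=> i; rewrite mem_undup codom_f.
Qed.

Lemma mem_wts a v : root_space a v -> v <> 0 -> a \in wts.
Proof.
move=> av v0; apply: contrapT => /negP aw; apply: v0.
rewrite -(vproj_id av) /vproj big1// => i /eqP wi.
by move: aw; rewrite -wi mem_undup codom_f.
Qed.

Lemma wts_root a : a \in wts -> a <> 0 -> fin_roots a.
Proof.
rewrite mem_undup => /codomP[i ->] w0; split=> //; exists e`_i => //.
by apply/eqP; apply: (basis_not0 eb); rewrite mem_nth ?size_tuple.
Qed.

Lemma root_wts a : fin_roots a -> a \in wts.
Proof. by move=> [_ [v]]; apply: mem_wts. Qed.

Lemma root_space_lie a b u v :
  root_space a u -> root_space b v -> root_space (a + b) [lie u, v].
Proof.
move=> au bv H; rewrite lie_derivation au bv lieZl lieZr -scalerDl.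
by rewrite add_lfunE.
Qed.

Lemma root_space0 v : root_space (0 : hdual h) v <-> v \in h.
Proof.
split=> [v0|vh H]; last first.
  by rewrite zero_lfunE scale0r (cartan_abelian Ch)// subvsP.
apply: (cartan_self_centralizing Ch) => y yh.
by have := v0 (vsproj h y); rewrite vsprojK// zero_lfunE scale0r.
Qed.

Lemma fin_root_neq0 a : fin_roots a -> a != 0.
Proof. by move=> [/eqP]. Qed.

Lemma formDl u v x : B (u + v) x = B u x + B v x.
Proof. by have := form_linear B x 1 u v; rewrite scale1r mul1r. Qed.

Lemma formZl c u x : B (c *: u) x = c * B u x.
Proof. by have := form_linear B x c u 0; rewrite Defs.form0l !addr0. Qed.

Lemma formDr u v x : B x (u + v) = B x u + B x v.
Proof. by rewrite !(form_sym B x) formDl. Qed.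

Lemma formZr c u x : B x (c *: u) = c * B x u.
Proof. by rewrite !(form_sym B x) formZl. Qed.

Lemma form0r x : B x 0 = 0. Proof. by rewrite form_sym Defs.form0l. Qed.

Lemma form_sumr (I : Type) (s : seq I) (F : I -> L) x :
  B x (\sum_(i <- s) F i) = \sum_(i <- s) B x (F i).
Proof. by elim/big_rec2: _ => [|i _ u _ <-]; rewrite ?form0r ?formDr. Qed.

Lemma hdualMn a j H : (a *+ j) H = j%:R * a H :> K.
Proof. by rewrite -scaler_nat scale_lfunE. Qed.

(** Invariance gives (a + b)(H) B(u, v) = 0 for all H, and some H makes the first factor nonzero. *)
Lemma form_root_spaces a b u v :
  root_space a u -> root_space b v -> a + b <> 0 -> B u v = 0.
Proof.
move=> au bv ab.
have [H /eqP Hab] : exists H, (a + b) H <> 0.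
  apply: contrapT => /forallNP aH; apply: ab; apply/lfunP => H.
  by rewrite zero_lfunE; apply: contrapT; apply: aH.
apply: (mulfI Hab); rewrite mulr0 add_lfunE.
rewrite -[(_ + _) * _]/(((a H : K) + (b H : K)) * B u v) mulrDl.
by rewrite -formZl -au -formZr -bv lieC -scaleN1r formZl form_invariant mulN1r addNr.
Qed.

(** [u] is orthogonal to every weight space except that of -a, so nondegeneracy must show there.
    This yields opposite roots and, for a = 0, nondegeneracy on h. *)
Lemma root_dual a u : root_space a u -> u <> 0 ->
  exists2 v, root_space (- a) v & B u v = 1.
Proof.
move=> au u0.
have [y /eqP By] : exists y, B u y <> 0.
  apply: contrapT => /forallNP By; apply: u0.
  by apply: (@form_nondegenerate _ _ B) => y; apply: contrapT.
have Buy : B u y = B u (vproj (- a) y).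
  have au0 b : b != - a -> B u (vproj b y) = 0.
    move=> ba; apply: form_root_spaces au (vproj_root _ _) _ => /eqP.
    by rewrite addrC addr_eq0 (negbTE ba).
  have [aw|aw] := boolP (- a \in wts); last first.
    move: By; rewrite {1}[y]vproj_sum form_sumr big1_seq ?eqxx// => b /andP[_ bw].
    by apply: au0; apply: contra aw => /eqP <-.
  rewrite {1}[y]vproj_sum form_sumr (bigD1_seq (- a)) ?undup_uniq//= big1 ?addr0//.
exists ((B u y)^-1 *: vproj (- a) y).
  by apply: (subspaceZ (root_space_subspace _)); apply: vproj_root.
by rewrite formZr -Buy mulVf.
Qed.

Lemma root_opp a : fin_roots a -> fin_roots (- a).
Proof.
move=> [a0 [u au u0]]; split; first by apply/eqP; rewrite oppr_eq0; apply/eqP.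
have [v av Buv] := root_dual au u0; exists v => // v0.
by move: Buv; rewrite v0 form0r => /esym/eqP; rewrite oner_eq0.
Qed.

Lemma cartan_form_nondegenerate x :
  x \in h -> (forall y, y \in h -> B x y = 0) -> x = 0.
Proof.
move=> xh xB; apply: contrapT => x0.
have [|y y0 Bxy] := root_dual (a := 0 : hdual h) _ x0; first exact/root_space0.
move: Bxy; rewrite xB; first by move=> /esym/eqP; rewrite oner_eq0.
by apply/root_space0; rewrite -[0]oppr0.
Qed.

(** Such an H is central; were the centre nonzero, simplicity would make L abelian. *)
Lemma cartan_centerless H : (forall a, fin_roots a -> a H = 0) -> H = 0.
Proof.
move=> aH.
pose P : set L := [set v | forall x, [lie x, v] = 0].
have [[x [y xy]] _] := simL.
apply: contrapT => H0.
have PT : forall v, P v.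
  apply: (ideal_full simL).
  - split=> [x'|c u v Pu Pv x']; first by rewrite lie0r.
    by rewrite lieDr lieZr Pu Pv scaler0 addr0.
  - by move=> x' y' Py z; rewrite Py lie0r.
  - exists (vsval H); last by move=> H'; apply: H0; apply: subvs_inj.
    move=> v; rewrite [v]coord_eb lie_suml big1// => i _.
    rewrite lieZl lieC ew.
    have [->|wi] := eqVneq (w i) 0; first by rewrite zero_lfunE scale0r oppr0 scaler0.
    rewrite aH ?scale0r ?oppr0 ?scaler0//; apply: wts_root; last exact/eqP.
    by rewrite mem_undup codom_f.
exact: xy (PT y x).
Qed.

Lemma root_lie_opp a u v H : root_space a u -> root_space (- a) v ->
  B [lie u, v] (vsval H) = a H * B u v.
Proof.
move=> au av; rewrite form_invariant lieC av -scaleN1r scalerA mulN1r opp_lfunE opprK.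
exact: formZr.
Qed.

Lemma root_lie_opp_cartan a u v : root_space a u -> root_space (- a) v ->
  [lie u, v] \in h.
Proof. by move=> au av; apply/root_space0; rewrite -(subrr a); apply: root_space_lie. Qed.

(** Through the form both sides represent the same multiple of a. Hence [g_a, g_-a] is at most a
    line, and coroots are unique before root spaces are known to be lines. *)
Lemma root_lie_opp_prop a u v u' v' : root_space a u -> root_space (- a) v ->
  root_space a u' -> root_space (- a) v' ->
  B u' v' *: [lie u, v] = B u v *: [lie u', v'].
Proof.
move=> au av au' av'; apply/eqP; rewrite -subr_eq0; apply/eqP.
have hB := root_lie_opp_cartan au av; have hB' := root_lie_opp_cartan au' av'.
apply: cartan_form_nondegenerate; first by rewrite rpredB ?rpredZ.
move=> y /vsprojK <-; rewrite formDl -scaleN1r !formZl.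
rewrite (root_lie_opp _ au av) (root_lie_opp _ au' av').
by rewrite mulN1r [X in X - _]mulrCA [X in _ - X]mulrCA [B u v * _]mulrC subrr.
Qed.

Lemma iter_root_space a b x v j : root_space a x -> root_space b v ->
  root_space (b + a *+ j) (iter j (lie x) v).
Proof.
move=> ax bv; elim: j => [|j IHj]; first by rewrite addr0.
by rewrite iterS mulrS addrCA; apply: root_space_lie.
Qed.

(** The weights b + j a are pairwise distinct in characteristic 0, and there are only finitely many
    weights. *)
Lemma iter_lie_eq0 a b x v : a != 0 -> root_space a x -> root_space b v ->
  exists j, iter j (lie x) v = 0.
Proof.
move=> a0 ax bv; apply: contrapT => /forallNP nz.
pose s := [seq b + a *+ j | j <- iota 0 (size wts).+1].
have us : uniq s.
  rewrite map_inj_uniq ?iota_uniq// => i j /addrI /eqP.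
  rewrite -!scaler_nat -subr_eq0 -scalerBl scaler_eq0 (negbTE a0) orbF subr_eq0.
  by rewrite eqr_nat => /eqP.
have /(uniq_leq_size us) : {subset s <= wts}.
  by move=> _ /mapP[j _ ->]; apply: mem_wts (iter_root_space j ax bv) (nz j).
by rewrite size_map size_iota ltnn.
Qed.

Lemma iter_lie_last a b x v : a != 0 -> root_space a x -> root_space b v -> v <> 0 ->
  exists j, iter j (lie x) v <> 0 /\ [lie x, iter j (lie x) v] = 0.
Proof.
move=> a0 ax bv v0; have [m vm] := iter_lie_eq0 a0 ax bv.
have ex : exists m, iter m (lie x) v == 0 by exists m; apply/eqP.
case: (ex_minnP ex) => [[|j]] /eqP vj jmin; first by [].
by exists j; split=> // /eqP /jmin; rewrite ltnn.
Qed.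

(* For [a H = 2] this is the sl2 computation; for [a H = 0] the Heisenberg one. *)
Lemma lie_iter_lower a b x y v H j : root_space a x -> root_space (- a) y ->
  vsval H = [lie x, y] -> root_space b v -> [lie x, v] = 0 ->
  [lie x, iter j.+1 (lie y) v] =
    (j.+1%:R * b H - 'C(j.+1, 2)%:R * a H) *: iter j (lie y) v.
Proof.
move=> ax ay Hxy bv xv; elim: j => [|j IHj].
  by rewrite /= lie_derivation xv lie0r addr0 -Hxy bv mul1r mul0r subr0.
rewrite iterS lie_derivation IHj lieZr -iterS -Hxy (iter_root_space _ ay bv).
rewrite -scalerDl; congr (_ *: _).
rewrite add_lfunE mulNrn opp_lfunE hdualMn.
rewrite (binS j.+1 1) bin1 natrD -(natr1 j.+1).
move: (a H : K) (b H : K) => aH bH; ring.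
Qed.

(** For the last exponent c with a nonzero lowered vector, [lie_iter_lower] forces (c+1) b(H) =
    binom(c+1, 2) a(H). The value a(H) is left free so that the same formula can exclude a(H) = 0 in
    the next lemma. *)
Lemma highest_weight a b x y v H : a != 0 -> root_space a x -> root_space (- a) y ->
  vsval H = [lie x, y] -> root_space b v -> [lie x, v] = 0 -> v <> 0 ->
  exists c : nat, (forall j, (j <= c)%N -> iter j (lie y) v <> 0) /\
    2%:R * b H = c%:R * a H.
Proof.
move=> a0 ax ay Hxy bv xv v0.
have na0 : - a != 0 by rewrite oppr_eq0.
have [m vm] := iter_lie_eq0 na0 ay bv.
have ex : exists m, iter m (lie y) v == 0 by exists m; apply/eqP.
case: (ex_minnP ex) => [[|c]] /eqP vc cmin; first by [].
exists c; split=> [j jc /eqP /cmin|]; first by rewrite ltnNge jc.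
have /eqP := lie_iter_lower c ax ay Hxy bv xv; rewrite vc lie0r eq_sym scaler_eq0.
have -> : (iter c (lie y) v == 0) = false.
  by apply/eqP => /eqP /cmin; rewrite ltnn.
have /(congr1 (fun m => m%:R : K)) := mul_bin_diag c.+1 1.
rewrite bin1 !natrM orbF => C2 /eqP bc.
have c0 : c.+1%:R != 0 :> K by rewrite pnatr_eq0.
apply: (mulfI c0); rewrite mulrCA [RHS]mulrA C2 -mulrA.
by apply/eqP; rewrite -subr_eq0 -mulrBr bc mulr0.
Qed.

(** If a(H) = 0, the top of each a-string forces b(H) = 0 for every root b, so H is central and
    vanishes; but H represents a nonzero multiple of a through the form. *)
Lemma root_form_lie_neq0 a x y H : fin_roots a -> root_space a x ->
  root_space (- a) y -> vsval H = [lie x, y] -> B x y <> 0 -> a H <> 0.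
Proof.
move=> ra ax ay Hxy Bxy aH; have a0 := fin_root_neq0 ra.
have H0 : H = 0.
  apply: cartan_centerless => b [_ [v bv v0]].
  have [j [vj xvj]] := iter_lie_last a0 ax bv v0.
  have [c [_]] := highest_weight a0 ax ay Hxy (iter_root_space j ax bv) xvj vj.
  rewrite add_lfunE hdualMn aH mulr0 addr0 mulr0 => /eqP.
  by rewrite mulf_eq0 pnatr_eq0 => /eqP.
case/eqP: a0; apply/lfunP => H'; rewrite zero_lfunE; apply: (mulIf (introN eqP Bxy)).
by rewrite -(root_lie_opp _ ax ay) -Hxy H0 linear0 Defs.form0l mul0r.
Qed.

(** * Triples of type sl2, coroots and root strings *)

Definition sl2_triple a x y H : Prop :=
  [/\ root_space a x, root_space (- a) y, vsval H = [lie x, y] & a H = 2%:R].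

Lemma sl2_triple_ex a x : fin_roots a -> root_space a x -> x <> 0 ->
  exists y H, sl2_triple a x y H.
Proof.
move=> ra ax x0; have [y ay Bxy] := root_dual ax x0.
pose H := vsproj h [lie x, y].
have Hxy : vsval H = [lie x, y] by rewrite vsprojK// (root_lie_opp_cartan ax ay).
have /eqP aH : a H <> 0.
  by apply: root_form_lie_neq0 ra ax ay Hxy _ => /eqP; rewrite Bxy oner_eq0.
pose c : K := 2%:R / a H.
exists (c *: y), (c *: H); split=> //.
- exact: (subspaceZ (root_space_subspace _)).
- by rewrite linearZ /= Hxy lieZr.
- by rewrite linearZ /= -[LHS]/(c * a H) divfK.
Qed.

Lemma sl2_triple_form a x y H : sl2_triple a x y H -> B x y <> 0.
Proof.
move=> [ax ay Hxy aH] Bxy.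
have H0 : H = 0.
  apply: subvs_inj; rewrite linear0; apply: cartan_form_nondegenerate; first exact: subvsP.
  by move=> z /vsprojK <-; rewrite Hxy (root_lie_opp _ ax ay) Bxy mulr0.
by move/eqP: aH; rewrite H0 linear0 eq_sym pnatr_eq0.
Qed.

Lemma sl2_triple_uniq a x y H x' y' H' :
  sl2_triple a x y H -> sl2_triple a x' y' H' -> H = H'.
Proof.
move=> t t'; have := sl2_triple_form t; have /eqP := sl2_triple_form t'.
move: t t' => [ax ay Hxy aH] [ax' ay' Hxy' aH'] B' /eqP B0.
have e1 : B x' y' *: H = B x y *: H'.
  by apply: subvs_inj; rewrite !linearZ /= Hxy Hxy'; apply: root_lie_opp_prop ax ay ax' ay'.
have /eqP := congr1 a e1; rewrite !linearZ /= aH aH' -!/(_ * _).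
rewrite -[X in X == _]/(B x' y' * 2%:R) -[X in _ == X]/(B x y * 2%:R).
rewrite (inj_eq (mulIf _)) ?pnatr_eq0// => /eqP e2.
by move: e1; rewrite e2 => /(scalerI B0).
Qed.

Lemma coroot_sl2_triple a x y H : sl2_triple a x y H -> coroot a = H.
Proof.
move=> t; apply: xget_subset1.
  by case: t => ax ay Hxy aH; split=> //; exists x, y.
move=> H1 H2 [a1 [x1 [y1 [? ? ?]]]] [a2 [x2 [y2 [? ? ?]]]].
exact: (sl2_triple_uniq (a := a) (x := x1) (y := y1) (x' := x2) (y' := y2)).
Qed.

Lemma coroot_triple a x : fin_roots a -> root_space a x -> x <> 0 ->
  exists y, sl2_triple a x y (coroot a).
Proof.
move=> ra ax x0; have [y [H t]] := sl2_triple_ex ra ax x0.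
by exists y; rewrite (coroot_sl2_triple t).
Qed.

Lemma coroot_tripleT a : fin_roots a -> exists x y, sl2_triple a x y (coroot a).
Proof.
by move=> ra; have [_ [x ax x0]] := ra; exists x; apply: coroot_triple.
Qed.

Lemma root_coroot a : fin_roots a -> a (coroot a) = 2%:R.
Proof. by move=> /coroot_tripleT[x [y []]]. Qed.

Lemma coroot_opp a : fin_roots a -> coroot (- a) = - coroot a.
Proof.
move=> ra; have [x [y [ax ay Hxy aH]]] := coroot_tripleT ra.
apply: (coroot_sl2_triple (x := y) (y := x)); split; rewrite ?opprK//.
  by rewrite linearN /= Hxy lieC opprK.
by rewrite opp_lfunE linearN opprK.
Qed.

(** Pairing with a nonzero x in g_-a is injective on g_a: a z in the kernel commutes with x, so it
    would be a highest weight vector for the triple of -a with weight -2, where a natural number is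
    required. *)
Lemma root_space_line a u v : fin_roots a -> root_space a u -> u <> 0 ->
  root_space a v -> exists c : K, v = c *: u.
Proof.
move=> ra au u0 av.
have [_ [x ax x0]] := root_opp ra.
have [y [nax nay Hxy nH]] := coroot_triple (root_opp ra) ax x0.
have kill z : root_space a z -> B x z = 0 -> z = 0.
  move=> az Bxz; apply: contrapT => z0.
  have xz : [lie x, z] = 0.
    apply: cartan_form_nondegenerate; first by apply: (root_lie_opp_cartan ax); rewrite opprK.
    by move=> H /vsprojK <-; rewrite (root_lie_opp _ ax) ?opprK// Bxz mulr0.
  have [c [_]] := highest_weight (fin_root_neq0 (root_opp ra)) ax nay Hxy az xz z0.
  have -> : a (coroot (- a)) = - 2%:R by rewrite -nH opp_lfunE opprK.
  rewrite nH mulrN => /eqP; rewrite eq_sym -subr_eq0 opprK -mulrDl mulf_eq0.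
  by rewrite -natrD !pnatr_eq0 addnS.
have /eqP Bxu : B x u <> 0 by move=> /(kill _ au).
exists (B x v / B x u); apply/eqP; rewrite -subr_eq0; apply/eqP.
apply: kill.
  apply: (subspaceB (root_space_subspace _)) av _.
  exact: (subspaceZ (root_space_subspace _)).
by rewrite formDr -scaleN1r !formZr mulN1r divfK// subrr.
Qed.

(** [i] counts the raising steps from [v] to the top of its string, each adding 2, and [c] is the
    highest weight found there. *)
Lemma weight_coroot a b v : fin_roots a -> root_space b v -> v <> 0 ->
  exists i c : nat, b (coroot a) = c%:R - i%:R * 2%:R /\
  exists x y v', [/\ sl2_triple a x y (coroot a), root_space (b + a *+ i) v',
    [lie x, v'] = 0 & forall j, (j <= c)%N -> iter j (lie y) v' <> 0].
Proof.
move=> ra bv v0; have [x [y t]] := coroot_tripleT ra; have [ax ay Hxy aH] := t.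
have a0 := fin_root_neq0 ra.
have [i [vi xvi]] := iter_lie_last a0 ax bv v0.
have [c [cP]] := highest_weight a0 ax ay Hxy (iter_root_space i ax bv) xvi vi.
rewrite aH [RHS]mulrC add_lfunE hdualMn aH => /mulfI.
rewrite pnatr_eq0 => /(_ isT) cE; exists i, c; split.
  by rewrite -cE addrK.
by exists x, y, (iter i (lie x) v); split=> //; apply: iter_root_space.
Qed.

Lemma weight_coroot_int a b v : fin_roots a -> root_space b v -> v <> 0 ->
  exists m : int, b (coroot a) = m%:~R.
Proof.
move=> ra bv v0; have [i [c [-> _]]] := weight_coroot ra bv v0.
by exists (c%:Z - i%:Z * 2%:Z); rewrite rmorphB rmorphM.
Qed.

(** Lowering the top vector i + j times reaches b - j a, and i + j <= c because c = m + 2i. *)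
Lemma root_string a b v (m j : nat) : fin_roots a -> root_space b v -> v <> 0 ->
  b (coroot a) = m%:R -> (j <= m)%N ->
  exists2 v', root_space (b - a *+ j) v' & v' <> 0.
Proof.
move=> ra bv v0.
have [i [c [-> [x [y [v' [[_ ay _ _] bv' _ cP]]]]]]] := weight_coroot ra bv v0.
move=> /eqP; rewrite subr_eq -natrM -natrD eqr_nat => /eqP cE jm.
exists (iter (i + j) (lie y) v'); last by apply: cP; rewrite cE addnC; lia.
have := iter_root_space (i + j) ay bv'.
by rewrite mulNrn mulrnDr opprD !addrA addrK.
Qed.

(** If [u, u'] = 0, then u' is a top vector for the triple of a. A top vector above g_(a+b), lowered
    j + 1 times, falls in the line of u', so raising it once must give 0; yet [lie_iter_lower]
    produces the factor (j+1)(c-j), nonzero because c = c0 + 2(j+1). *)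
Lemma lie_roots_neq0 a b u u' : fin_roots a -> fin_roots b -> fin_roots (a + b) ->
  root_space a u -> root_space b u' -> u <> 0 -> u' <> 0 -> [lie u, u'] <> 0.
Proof.
move=> ra rb [_ [z az z0]] au bu' u0 u'0 uu'; have a0 := fin_root_neq0 ra.
have [y [_ ay Hxy aH]] := coroot_triple ra au u0.
have [c0 [_]] := highest_weight a0 au ay Hxy bu' uu' u'0.
rewrite aH [RHS]mulrC => /mulfI; rewrite pnatr_eq0 => /(_ isT) bH.
have [j [vj xvj]] := iter_lie_last a0 au az z0.
have bj := iter_root_space j au az.
have [c [cP]] := highest_weight a0 au ay Hxy bj xvj vj.
set v := iter j _ z in xvj vj bj cP *.
have wH : (a + b + a *+ j) (coroot a) = (c0 + j.+1 * 2)%:R.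
  rewrite !add_lfunE hdualMn aH bH.
  rewrite natrD natrM -(natr1 j); ring.
rewrite wH aH [RHS]mulrC => /mulfI; rewrite pnatr_eq0 => /(_ isT) /eqP.
rewrite eqr_nat => /eqP cE.
have [k kE] : exists k : K, iter j.+1 (lie y) v = k *: u'.
  apply: root_space_line rb bu' u'0 _.
  have := iter_root_space j.+1 ay bj.
  by rewrite mulNrn mulrS opprD addrA [a + b]addrC addrAC addrK addrK.
have /eqP := lie_iter_lower j au ay Hxy bj xvj.
rewrite kE lieZr uu' scaler0 eq_sym scaler_eq0 aH wH => /orP[|/eqP]; last first.
  by apply: cP; rewrite -cE; lia.
rewrite -!natrM subr_eq0 eqr_nat (mulnC 'C(_, _)) -mul_bin_diag bin1 eqn_pmul2l//.
by move=> /eqP; lia.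
Qed.

(** Up to nonzero factors both pairings are the value of B at the two coroots. *)
Lemma coroot_pairing_neq0 a b : fin_roots a -> fin_roots b ->
  b (coroot a) <> 0 -> a (coroot b) <> 0.
Proof.
move=> ra rb ba ab; apply: ba.
have [x [y [ax ay Hxy _]]] := coroot_tripleT ra.
have [x' [y' t']] := coroot_tripleT rb; have /eqP B' := sl2_triple_form t'.
have [bx' by' Hxy' _] := t'; apply: (mulIf B').
by rewrite -(root_lie_opp _ bx' by') -Hxy' form_sym Hxy (root_lie_opp _ ax ay) ab !mul0r.
Qed.

(** * Simple roots and the trace form *)

(** The Killing form restricted to h. [B] is fixed only up to a scalar of K, so it has no sign; this
    form is a sum of squares of integers at each coroot. *)
Definition trace_form H H' : K := \sum_i (w i H : K) * (w i H' : K).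

(** Rows are images of basis vectors, so products appear in reverse order in [ad_mx_lie]. *)
Definition ad_mx x : 'M[K]_n := \matrix_(i, j) coord e j [lie x, e`_i].

Lemma lie_ad_mx x (i : 'I_n) : [lie x, e`_i] = \sum_j ad_mx x i j *: e`_j.
Proof. by rewrite {1}[ [lie x, _] ]coord_eb; apply: eq_bigr => j _; rewrite mxE. Qed.

Lemma ad_mx_lie x y : ad_mx [lie x, y] = ad_mx y *m ad_mx x - ad_mx x *m ad_mx y.
Proof.
apply/matrixP => i j; rewrite mxE.
have -> : [lie [lie x, y], e`_i] = [lie x, [lie y, e`_i]] - [lie y, [lie x, e`_i]].
  by rewrite [in RHS](lie_derivation x) addrK.
rewrite linearB /= (lie_ad_mx y) (lie_ad_mx x) !lie_sumr !linear_sum !mxE -sumrB.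
rewrite -sumrB; apply: eq_bigr => k _.
by rewrite !lieZr !linearZ /= !mxE.
Qed.

Lemma ad_mx_cartan H i j : ad_mx (vsval H) i j = if i == j then w i H else 0.
Proof.
rewrite mxE ew linearZ /= coord_free ?(basis_free eb)//.
by case: eqP => _; rewrite ?mulr1 ?mulr0.
Qed.

Lemma trace_form_ad H H' : trace_form H H' = \tr (ad_mx (vsval H) *m ad_mx (vsval H')).
Proof.
apply: eq_bigr => i _; rewrite mxE (bigD1 i)//= !ad_mx_cartan eqxx big1 ?addr0// => j ji.
by rewrite !ad_mx_cartan eq_sym (negbTE ji) mul0r.
Qed.

Lemma ad_mxZ c x : ad_mx (c *: x) = c *: ad_mx x.
Proof. by apply/matrixP => i j; rewrite !mxE lieZl linearZ. Qed.

(** Cyclicity of the trace moves the bracket from [x, y] to [y, H'] = a(H') y. *)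
Lemma trace_form_lie a x y H H' : root_space (- a) y -> vsval H = [lie x, y] ->
  trace_form H H' = a H' * \tr (ad_mx x *m ad_mx y).
Proof.
move=> ay Hxy; rewrite trace_form_ad Hxy ad_mx_lie mulmxBl linearB /=.
rewrite -mulmxA mxtrace_mulC -!mulmxA -linearB /= -mulmxBr -ad_mx_lie.
by rewrite lieC ay opp_lfunE scaleNr opprK ad_mxZ -scalemxAr linearZ.
Qed.

Lemma trace_form_coroot a H : fin_roots a ->
  2%:R * trace_form (coroot a) H = trace_form (coroot a) (coroot a) * a H.
Proof.
move=> ra; have [x [y [_ ay Hxy aH]]] := coroot_tripleT ra.
rewrite !(trace_form_lie _ ay Hxy) aH -[RHS]mulrA; congr (_ * _); exact: mulrC.
Qed.

Lemma trace_formZl c H H' : trace_form (c *: H) H' = c * trace_form H H'.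
Proof.
by rewrite mulr_sumr; apply: eq_bigr => i _; rewrite linearZ /= -[_ *: _]/(_ * _) mulrA.
Qed.

Lemma trace_form_suml (I : Type) (s : seq I) (F : I -> subvs_of h) H :
  trace_form (\sum_(i <- s) F i) H = \sum_(i <- s) trace_form (F i) H.
Proof.
by rewrite exchange_big; apply: eq_bigr => i _; rewrite linear_sum mulr_suml.
Qed.

Lemma w_coroot_int a i : fin_roots a -> exists m : int, w i (coroot a) = m%:~R.
Proof.
move=> ra; apply: weight_coroot_int ra (ew i) _.
by apply/eqP; apply: (basis_not0 eb); rewrite mem_nth ?size_tuple.
Qed.

(** The terms are squares of integers, and the weight a itself contributes 4. *)
Lemma trace_form_coroot_gt0 a : fin_roots a -> 0 < trace_form (coroot a) (coroot a).
Proof.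
move=> ra; have aw := root_wts ra.
have sq_ge0 i : 0 <= (w i (coroot a) : K) * w i (coroot a).
  by have [m ->] := w_coroot_int i ra; rewrite -rmorphM ler0z -expr2 sqr_ge0.
have := aw; rewrite mem_undup => /codomP[i ai].
rewrite /trace_form (bigD1 i)//= ltr_pwDl ?sumr_ge0// -ai root_coroot//.
by rewrite -natrM ltr0n.
Qed.

(** Integral values, not merely nonzero ones, are wanted: the positive ones serve as a height for
    induction. *)
Lemma separating_element : exists H0, forall a, fin_roots a ->
  exists2 m : int, a H0 = m%:~R & m != 0.
Proof.
pose r := [seq a <- wts | a != 0].
have rP a : a \in r <-> fin_roots a.
  rewrite mem_filter; split=> [/andP[/eqP a0 aw]|ra]; first exact: wts_root.
  by rewrite fin_root_neq0// root_wts.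
(* Evaluating [p a] at N evaluates a at the combination of coroots with coefficients N^i. The
   polynomial is nonzero because its coefficient at the index of a is 2. *)
pose p a : {poly K} := \poly_(i < size r) (a (coroot r`_i) : K).
have p0 a : fin_roots a -> p a != 0.
  move=> /[dup] ra /rP ar; apply/eqP => /(congr1 (fun q : {poly K} => q`_(index a r))).
  rewrite coef_poly index_mem ar nth_index// root_coroot// coef0 => /eqP.
  by rewrite pnatr_eq0.
have pp0 : \prod_(a <- r) p a != 0.
  by rewrite prodf_seq_neq0; apply/allP => a /rP /p0 ->.
have [N NP] : exists N : nat, ~~ root (\prod_(a <- r) p a) N%:R.
  apply: contrapT => /forallNP Nr; set q := \prod_(a <- r) _ in pp0 Nr.
  have := max_poly_roots pp0 (rs := [seq i%:R | i <- iota 0 (size q)]).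
  rewrite size_map size_iota ltnn => /(_ _ _)/negP; apply=> //.
  - by apply/allP => _ /mapP[i _ ->]; apply/negPn/negP/Nr.
  - by rewrite map_inj_uniq ?iota_uniq// => i j /eqP; rewrite eqr_nat => /eqP.
exists (\sum_(i < size r) N%:R ^+ i *: coroot r`_i) => a ra.
have aE : a (\sum_(i < size r) N%:R ^+ i *: coroot r`_i) = (p a).[N%:R].
  rewrite linear_sum horner_poly; apply: eq_bigr => i _.
  by rewrite linearZ /= mulrC.
have [m mE] : exists m : int, (p a).[N%:R] = m%:~R.
  have mP (i : 'I_(size r)) : exists m : int, a (coroot r`_i) = m%:~R :> K.
    have [_ [v av v0]] := ra; apply: weight_coroot_int av v0.
    by apply/rP; rewrite mem_nth.
  have [f fP] := choice mP.
  exists (\sum_(i < size r) f i * N%:Z ^+ i); rewrite horner_poly rmorph_sum.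
  by apply: eq_bigr => i _; rewrite rmorphM rmorphXn /= fP.
exists m; first by rewrite aE.
apply: contra NP => /eqP m0; rewrite /root.
by rewrite horner_prod (bigD1_seq a)/= ?filter_uniq ?undup_uniq ?rP// mE m0 mul0r.
Qed.

(** * Simple roots and their independence over the integers *)

Section SimpleRoots.
Variable H0 : subvs_of h.
Hypothesis H0P : forall a, fin_roots a -> exists2 m : int, a H0 = m%:~R & m != 0.

Definition pos_root a : Prop := fin_roots a /\ 0 < (a H0 : K).

Lemma pos_rootP a : fin_roots a -> pos_root a \/ pos_root (- a).
Proof.
move=> ra; have [m am m0] := H0P ra.
have [|m_lt0|m_eq0] := ltgtP m 0; last by rewrite m_eq0 eqxx in m0.
  right; split; first exact: root_opp.
  by rewrite opp_lfunE am oppr_gt0 ltrz0.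
by left; split=> //; rewrite am ltr0z.
Qed.

Definition simple_root a : Prop :=
  pos_root a /\ forall b c, pos_root b -> pos_root c -> a <> b + c.

(** Induction on the natural number a(H0), which is smaller for both summands of a decomposable
    positive root. *)
Lemma pos_root_ind (P : hdual h -> Prop) :
  (forall a, simple_root a -> P a) ->
  (forall a b, pos_root a -> pos_root b -> fin_roots (a + b) ->
     P a -> P b -> P (a + b)) ->
  forall a, pos_root a -> P a.
Proof.
move=> Psimple Padd.
have posE a : pos_root a -> exists k : nat, a H0 = k.+1%:R :> K.
  move=> [ra]; have [[[|k]|k] -> _] := H0P ra; rewrite ?ltxx ?ltr0z// => _.
  by exists k.
suff Pk k a : pos_root a -> a H0 = k%:R :> K -> P a.
  by move=> a pa; have [k ak] := posE _ pa; apply: Pk ak.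
elim/ltn_ind: k a => k IHk a pa ak.
have [sa|] := pselect (simple_root a); first exact: Psimple.
move=> /not_andP[//|/existsNP[b /existsNP[c]]].
move=> /not_implyP[pb /not_implyP[pc /contrapT abc]].
have [kb bk] := posE _ pb; have [kc ck] := posE _ pc.
have /eqP : (kb.+1 + kc.+1)%N%:R = k%:R :> K by rewrite -ak abc add_lfunE bk ck natrD.
rewrite eqr_nat => /eqP kE; rewrite abc.
apply: Padd => //; first by rewrite -abc; case: pa.
  by apply: (IHk _ _ b pb bk); lia.
by apply: (IHk _ _ c pc ck); lia.
Qed.

(** A positive pairing makes a - b a root; whichever sign it has, a or b then decomposes into
    positive roots. *)
Lemma simple_root_pairing a b : simple_root a -> simple_root b -> a <> b ->
  (a (coroot b) : K) <= 0.
Proof.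
move=> [pa sa] [pb sb] ab.
have [[_ [v av v0]] _] := pa; have [rb _] := pb.
have [m abm] := weight_coroot_int rb av v0.
rewrite abm lerz0 leNgt; apply/negP; case: m abm => [[//|m] abm _|//].
have [|v' av' v'0] := root_string (j := 1) rb av v0 abm; first by [].
have rab : fin_roots (a - b) by split; [move/subr0_eq/ab|exists v'].
case: (pos_rootP rab) => pab.
  by apply: (sa _ _ pab pb); rewrite subrK.
by apply: (sb _ _ pab pa); rewrite opprB subrK.
Qed.

Definition simple_roots : seq (hdual h) := [seq a <- wts | `[< simple_root a >]].

Lemma simple_rootsP a : a \in simple_roots <-> simple_root a.
Proof.
rewrite mem_filter; split=> [/andP[/asboolP]//|sa].
by rewrite root_wts ?andbT; [apply/asboolP|case: sa => -[]].
Qed.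

Definition simple_comb (c : hdual h -> int) : hdual h :=
  \sum_(a <- simple_roots) a *~ c a.

Lemma simple_combD c d : simple_comb (fun a => c a + d a) = simple_comb c + simple_comb d.
Proof. by rewrite -big_split; apply: eq_bigr => a _; rewrite mulrzDr. Qed.

Lemma simple_combN c : simple_comb (fun a => - c a) = - simple_comb c.
Proof. by rewrite -sumrN; apply: eq_bigr => a _; rewrite mulrNz. Qed.

Lemma simple_combE c H :
  simple_comb c H = \sum_(a <- simple_roots) (c a)%:~R * (a H : K) :> K.
Proof.
rewrite sum_lfunE; apply: eq_bigr => a _.
by rewrite -scaler_int scale_lfunE.
Qed.

(* Positive definiteness of the trace form on the rational span of the coroots,
   applied to the positive part of the relation. *)
Lemma simple_comb_le0 c : simple_comb c = 0 -> forall a, a \in simple_roots -> c a <= 0.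
Proof.
move=> c0; pose p a := Num.max (c a) 0; pose m a := Num.max (- c a) 0.
have pm : simple_comb p = simple_comb m.
  apply/eqP; rewrite -subr_eq0 -simple_combN -simple_combD -c0; apply/eqP.
  by apply: eq_bigr => a _; congr (_ *~ _); rewrite /p /m; lia.
pose q a := trace_form (coroot a) (coroot a).
(* The positive multiple of the coroot that represents [a] through the trace form. *)
pose t a : subvs_of h := (2%:R / q a) *: coroot a.
have q0 a : a \in simple_roots -> 0 < q a.
  by move=> /simple_rootsP[[ra _] _]; apply: trace_form_coroot_gt0.
have tE a H : a \in simple_roots -> trace_form (t a) H = a H.
  move=> sa; have /simple_rootsP[[ra _] _] := sa.
  rewrite trace_formZl mulrAC trace_form_coroot// -/(q a) mulrAC mulfV ?mul1r//.
  by rewrite gt_eqF// q0.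
pose v := \sum_(a <- simple_roots) (p a)%:~R *: t a.
have vE H : trace_form v H = simple_comb p H.
  rewrite trace_form_suml simple_combE !big_seq; apply: eq_bigr => a sa.
  by rewrite trace_formZl tE.
(* Squares in K can be negative, so the values have to be real first. *)
have w_real i : (w i v : K) \is Num.real.
  rewrite linear_sum big_seq; apply: rpred_sum => a sa.
  have /simple_rootsP[[ra _] _] := sa; have [k wk] := w_coroot_int i ra.
  rewrite !linearZ /= wk; apply: realM; first exact: realz.
  by apply: realM; [apply: realM; rewrite ?realV ?gtr0_real ?q0|apply: realz].
have vv_ge0 i : 0 <= (w i v : K) * w i v by rewrite -expr2 real_exprn_even_ge0.
(* Replacing one factor p by m through the relation leaves diagonal terms m_a p_a = 0 and
   off-diagonal terms that are nonpositive by [simple_root_pairing]. *)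
have vv : trace_form v v <= 0.
  rewrite vE pm simple_combE big_seq; apply: sumr_le0 => a sa.
  rewrite linear_sum mulr_sumr big_seq; apply: sumr_le0 => b sb.
  rewrite !linearZ /= -[_ *: _]/((p b)%:~R * (2%:R / q b * (a (coroot b) : K))).
  have [<-|ab] := eqVneq a b.
    rewrite mulrA -rmorphM /= (_ : m a * p a = 0) ?mul0r//.
    by rewrite /m /p; nia.
  apply: mulr_ge0_le0; first by rewrite ler0z /m; lia.
  apply: mulr_ge0_le0; first by rewrite ler0z /p; lia.
  apply: mulr_ge0_le0; first by rewrite divr_ge0 ?ltW ?q0.
  by apply: simple_root_pairing; [apply/simple_rootsP|apply/simple_rootsP|apply/eqP].
have wv0 i : w i v = 0.
  have /psumr_eq0P/(_ i isT)/eqP : trace_form v v = 0.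
    by apply/eqP; rewrite eq_le vv sumr_ge0.
  by rewrite mulf_eq0 orbb => /(_ (fun i _ => vv_ge0 i))/eqP.
(* All weights vanish at v, so the combination with coefficients p vanishes at H0, where every
   simple root is positive. *)
have /eqP : simple_comb p H0 = 0 :> K.
  by rewrite -vE; apply: big1 => i _; rewrite wv0 mul0r.
have ss_gt0 a : a \in simple_roots -> 0 < (a H0 : K).
  by move=> /simple_rootsP[[]].
rewrite simple_combE big_seq psumr_eq0; last first.
  by move=> a /ss_gt0 /ltW aH; rewrite mulr_ge0 ?ler0z// /p; lia.
move=> /allP pa0 a sa; have := pa0 a sa.
by rewrite sa mulf_eq0 (gt_eqF (ss_gt0 _ sa)) orbF intr_eq0 /p; lia.
Qed.

Lemma simple_comb_inj c d : simple_comb c = simple_comb d ->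
  forall a, a \in simple_roots -> c a = d a.
Proof.
move=> cd a sa.
have le0 c' d' : simple_comb c' = simple_comb d' -> c' a <= d' a.
  move=> e'; rewrite -subr_le0; apply: (simple_comb_le0 (c := fun a => c' a - d' a)) sa.
  by rewrite (simple_combD c' (fun a => - d' a)) simple_combN e' subrr.
by apply/eqP; rewrite eq_le !le0.
Qed.

Lemma simple_comb_delta a : a \in simple_roots ->
  simple_comb (fun b => (b == a)%:Z) = a.
Proof.
move=> sa; rewrite /simple_comb (bigD1_seq a) ?filter_uniq ?undup_uniq//=.
by rewrite eqxx mulr1z big1 ?addr0// => b /negbTE->.
Qed.

Lemma pos_root_comb a : pos_root a -> exists c, a = simple_comb c.
Proof.
move: a; apply: pos_root_ind => [a /simple_rootsP sa|a b _ _ _ [c ->] [d ->]].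
  by exists (fun b => (b == a)%:Z); rewrite simple_comb_delta.
by exists (fun a => c a + d a); rewrite simple_combD.
Qed.

Lemma root_lattice_comb a : root_lattice a -> exists c, a = simple_comb c.
Proof.
move=> La; apply: (La [set b | exists c, b = simple_comb c]); split=> [|b rb].
  split=> [|b b' [c ->] [d ->]].
    by exists (fun=> 0); rewrite /simple_comb big1// => b _; rewrite mulr0z.
  by exists (fun a => c a + - d a); rewrite simple_combD simple_combN.
have [|] := pos_rootP rb; first exact: pos_root_comb.
move=> /pos_root_comb[c /(congr1 -%R)].
by rewrite opprK => ->; exists (fun a => - c a); rewrite simple_combN.
Qed.

End SimpleRoots.

(** Values at simple roots are free; additivity keeps F inside Z while positive roots are built from
    simple ones, and negation covers the other roots. *)
Lemma additive_family_lift (Z : hdual h -> int -> Prop) :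
  (forall a, fin_roots a -> exists r, Z a r) ->
  (forall a r, fin_roots a -> Z a r -> Z (- a) (- r)) ->
  (forall a b r r', fin_roots a -> fin_roots b -> fin_roots (a + b) ->
     Z a r -> Z b r' -> Z (a + b) (r + r')) ->
  exists F : hdual h -> int,
    (forall a b, root_lattice a -> root_lattice b -> F (a + b) = F a + F b) /\
    forall a, fin_roots a -> Z a (F a).
Proof.
move=> Zex ZN ZD; have [H0 H0P] := separating_element.
have rootsL a : fin_roots a -> root_lattice a by move=> ra Q [_]; apply.
have [p pP] : {p : hdual h -> int & forall a, fin_roots a -> Z a (p a)}.
  apply: (@choice _ _ (fun a r => fin_roots a -> Z a r)) => a.
  by have [/Zex[r]|] := pselect (fin_roots a); [exists r|exists 0].
pose s := simple_roots H0.
(* The value is demanded for every expression of the argument; independence of the simple roots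
   makes this consistent. Where no expression exists, 0 is a default. *)
have [F FP] : {F : hdual h -> int & forall a c, a = simple_comb H0 c ->
    F a = \sum_(b <- s) c b * p b}.
  apply: (@choice _ _ (fun a m => forall c, a = simple_comb H0 c ->
    m = \sum_(b <- s) c b * p b)) => a.
  have [[c ac]|nc] := pselect (exists c, a = simple_comb H0 c); last first.
    by exists 0 => c ac; case: nc; exists c.
  exists (\sum_(b <- s) c b * p b) => d; rewrite ac => cd.
  by apply: eq_big_seq => b bs; rewrite (simple_comb_inj H0P cd bs).
have FD a b : root_lattice a -> root_lattice b -> F (a + b) = F a + F b.
  move=> /(root_lattice_comb H0P)[c ac] /(root_lattice_comb H0P)[d bd].
  rewrite (FP _ _ ac) (FP _ _ bd) (FP _ (fun a => c a + d a)) ?simple_combD ?ac ?bd//.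
  by rewrite -big_split; apply: eq_bigr => b' _; rewrite mulrDl.
exists F; split=> // a ra.
have Fpos b : pos_root H0 b -> Z b (F b).
  move: b; apply: (pos_root_ind H0P).
    move=> b /[dup] [[[rb _] _]] /simple_rootsP sb.
    rewrite (FP _ _ (esym (simple_comb_delta sb))) (bigD1_seq b)/= ?filter_uniq ?undup_uniq//.
    by rewrite eqxx mul1r big1 ?addr0; [apply: pP|move=> c /negbTE->; rewrite mul0r].
  move=> b c [rb _] [rc _] rbc Zb Zc.
  by rewrite FD; [apply: ZD|apply: rootsL|apply: rootsL].
have [/Fpos//|pa] := pos_rootP H0P ra; rewrite -[a]opprK.
have F0 : F 0 = 0.
  have L0 : root_lattice (0 : hdual h) by move=> Q [[]].
  by apply: (addrI (F 0)); rewrite -FD ?addr0.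
have -> : F (- - a) = - F (- a).
  apply/eqP; rewrite -addr_eq0 -FD; last 2 first.
  - by rewrite opprK; apply: rootsL.
  - by apply: rootsL; apply: root_opp.
  by rewrite opprK subrr F0.
by apply: ZN; [apply: root_opp|apply: Fpos].
Qed.

(** * Connectedness and closed subroot systems *)

Lemma root_ex : exists a, fin_roots a.
Proof.
apply: contrapT => /forallNP noroot; have [[x [y xy]] _] := simL; apply: xy.
have eh (i : 'I_n) : e`_i \in h.
  apply/root_space0; suff <- : w i = 0 by apply: ew.
  apply: contrapT => wi; apply: (noroot (w i)); apply: wts_root wi.
  by rewrite mem_undup codom_f.
have Lh v : v \in h.
  by rewrite [v]coord_eb; apply: memv_suml => i _; apply: memvZ; apply: eh.
by apply: (cartan_abelian Ch).
Qed.

Lemma weight_cases (i : 'I_n) : w i = 0 \/ fin_roots (w i).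
Proof.
have [|wi] := pselect (w i = 0); first by left.
by right; apply: wts_root wi; rewrite mem_undup codom_f.
Qed.

Lemma lie_ideal_ind (P : set L) y : linear_subspace P ->
  (forall i : 'I_n, P [lie e`_i, y]) -> forall x, P [lie x, y].
Proof.
move=> linP Py x; rewrite [x]coord_eb lie_suml; apply: (subspace_sum linP) => i _ _.
by rewrite lieZl; apply: (subspaceZ linP).
Qed.

(** With c = a + b, the direct passage from a to c fails only if c(h_a) = 0. Then b(h_a) = -2 puts b
    in P, and a(h_c) = 0 gives b(h_c) = 2, which leads from b to c. *)
Lemma connected_root_sum (P : set (hdual h)) a b :
  (forall a b, P a -> fin_roots a -> fin_roots b -> b (coroot a) <> 0 -> P b) ->
  fin_roots a -> fin_roots b -> fin_roots (a + b) -> P a -> P (a + b).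
Proof.
move=> Pconn ra rb rc Pa.
have cc := root_coroot rc; rewrite add_lfunE in cc.
have [ac|/(coroot_pairing_neq0 rc ra) ca] := pselect (a (coroot (a + b)) = 0); last exact: Pconn ca.
have [ca|] := pselect ((a + b) (coroot a) = 0); last exact: Pconn.
have Pb : P b.
  apply: (Pconn _ _ Pa ra rb) => ba; move/eqP: ca.
  by rewrite add_lfunE root_coroot// ba addr0 pnatr_eq0.
apply: (Pconn _ _ Pb rb rc); apply: coroot_pairing_neq0 => // bc.
by move/eqP: cc; rewrite ac bc addr0 eq_sym pnatr_eq0.
Qed.

(* The root spaces and coroots of [P] span an ideal. *)
Lemma connected_roots (P : set (hdual h)) :
  (forall a b, P a -> fin_roots a -> fin_roots b -> b (coroot a) <> 0 -> P b) ->
  (exists2 a, fin_roots a & P a) -> forall a, fin_roots a -> P a.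
Proof.
move=> Pconn [a0 ra0 Pa0] b rb.
pose G : set L := [set v | exists a, [/\ fin_roots a, P a & root_space a v]] `|`
  [set v | exists a, [/\ fin_roots a, P a & v = vsval (coroot a)]].
have linI := lspan_subspace G; have GI := @subset_lspan _ _ G.
have idI x y : lspan G y -> lspan G [lie x, y].
  suff sub : lspan G `<=` [set y | forall x, lspan G [lie x, y]].
    by move=> /sub; apply.
  apply: lspan_min => [|{}y Gy {}x].
    split=> [x'|c u v Iu Iv x']; first by rewrite lie0r; apply: subspace0.
    by rewrite lieDr lieZr; apply: (subspaceD linI) => //; apply: (subspaceZ linI).
  apply: lie_ideal_ind => // i; case: Gy => [[a [ra Pa ay]]|[a [ra Pa ->]]].
    have [wi|ri] := weight_cases i.
      have eh : e`_i \in h by apply/root_space0; rewrite -wi.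
      by rewrite -(vsprojK eh) ay; apply: (subspaceZ linI); apply: GI; left; exists a.
    (* Opposite weights bracket into the line of the coroot, the second kind of generator. *)
    have [wia|wia] := eqVneq (w i) (- a).
      have [u [v t]] := coroot_tripleT ra; have [au av huv _] := t.
      have Bw := sl2_triple_form t.
      have ei : root_space (- a) e`_i by rewrite -wia.
      have := root_lie_opp_prop ay ei au av; rewrite -huv => ye.
      rewrite lieC -scaleN1r; apply: (subspaceZ linI).
      apply: (subspaceZK linI (introN eqP Bw)); rewrite ye.
      by apply: (subspaceZ linI); apply: GI; right; exists a.
    have [->|ey0] := pselect ([lie e`_i, y] = 0); first exact: subspace0.
    have wy := root_space_lie (ew i) ay.
    have rs : fin_roots (w i + a).
      by split; [move/eqP; rewrite addr_eq0 (negbTE wia)|exists [lie e`_i, y]].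
    apply: GI; left; exists (w i + a); split=> //; rewrite addrC.
    by apply: connected_root_sum; rewrite // addrC.
  rewrite lieC ew -scaleN1r; have [->|wa] := pselect (w i (coroot a) = 0).
    by rewrite scale0r scaler0; apply: subspace0.
  do 2 apply: (subspaceZ linI); apply: GI; left; exists (w i).
  have [wi|ri] := weight_cases i; first by rewrite wi zero_lfunE in wa.
  by split=> //; apply: Pconn wa.
have full v : lspan G v.
  apply: (ideal_full simL linI idI).
  have [_ [x ax x0]] := ra0; exists x => //; apply: GI; left; by exists a0.
have [_ [z bz z0]] := rb.
suff [//|/eqP] : P b \/ vproj b z = 0 by rewrite vproj_id// => /eqP.
(* If b were outside P, every generator, hence all of L, would project to 0 in g_b. *)
pose T : set L := [set v | P b \/ vproj b v = 0].
apply: (lspan_min (T := T)) (full z).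
  split; first by right; apply: vproj0.
  move=> c u v [Pb|bu]; first by left.
  by case=> [Pb|bv]; [left|right; rewrite vproj_linear bu bv scaler0 addr0].
move=> v [[a [ra Pa av]]|[a [ra Pa ->]]].
  have [ab|ab] := pselect (a = b); first by left; rewrite -ab.
  by right; apply: vproj_eq0 av ab.
right; apply: (vproj_eq0 (b := 0)); first by apply/root_space0/subvsP.
by move/esym; apply: rb.1.
Qed.

(** Negation is what a symmetric subalgebra provides; for closed sets of roots it is shown below to
    be equivalent to stability under reflections. *)
Definition closed_symmetric (P : set (hdual h)) : Prop :=
  [/\ P `<=` @fin_roots _ _ h, forall a, P a -> P (- a) &
      forall a b, P a -> P b -> fin_roots (a + b) -> P (a + b)].

(** Descending by a stays in P while every b - j a is a root, which fails only if the string meets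
    0. Then b = j a and m = 2j, so the string ends at -b. *)
Lemma closed_symmetric_string P a b (m : nat) : closed_symmetric P -> P a -> P b ->
  b (coroot a) = m%:R -> P (b - a *+ m).
Proof.
move=> [PR PN PD] Pa Pb bm; have ra := PR _ Pa; have [_ [v bv v0]] := PR _ Pb.
have [[j [jm bj]]|/forallNP noj] := pselect (exists j, (j <= m)%N /\ b = a *+ j).
  have mE : m = (j * 2)%N.
    apply/eqP; rewrite -(eqr_nat K) natrM -bm bj hdualMn root_coroot//.
  by rewrite mE muln2 -addnn mulrnDr opprD addrA -bj subrr add0r; apply: PN.
suff Pj j : (j <= m)%N -> P (b - a *+ j) by apply: Pj.
elim: j => [|j IHj] jm; first by rewrite subr0.
rewrite mulrSr opprD addrA; apply: PD; [exact/IHj/ltnW|exact: PN|].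
have [v' v'P v'0] := root_string ra bv v0 bm jm.
rewrite -addrA -opprD -mulrSr; split; last by exists v'.
by move=> /subr0_eq bj; apply: (noj j.+1).
Qed.

Lemma closed_symmetric_subroot P : closed_symmetric P -> closed_subroot_system P.
Proof.
move=> /[dup] cP [PR PN PD]; split=> // a b Pa Pb; have ra := PR _ Pa.
have [_ [v bv v0]] := PR _ Pb.
have [m bm] := weight_coroot_int ra bv v0; rewrite /reflection bm.
case: m bm => m bm; first by
  rewrite -[m%:~R]/(m%:R) scaler_nat; apply: closed_symmetric_string.
have := @closed_symmetric_string P (- a) b m.+1 cP (PN _ Pa) Pb.
rewrite NegzE mulrNz -pmulrn scaleNr scaler_nat mulNrn; apply.
by rewrite coroot_opp// linearN /= bm NegzE mulrNz opprK.
Qed.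

Lemma subroot_closed_symmetric P : closed_subroot_system P -> closed_symmetric P.
Proof.
move=> [PR Prefl PD]; split=> // a Pa; have := Prefl a a Pa Pa.
by rewrite /reflection (root_coroot (PR _ Pa)) scaler_nat mulr2n opprD addNKr.
Qed.

(** Induction on the number of weights outside Q, which drops at each strict enlargement. *)
Lemma maximal_closed_subroot_ex (P : set (hdual h)) : proper_closed_subroot_system P ->
  exists2 Q, maximal_closed_subroot_system Q & P `<=` Q.
Proof.
pose sz (Q : set (hdual h)) := count (fun a => `[< Q a >]) wts.
suff main k Q : proper_closed_subroot_system Q -> (size wts - sz Q <= k)%N ->
    exists2 Q', maximal_closed_subroot_system Q' & Q `<=` Q'.
  by move=> PP; apply: (main (size wts)); rewrite // leq_subr.
elim: k Q => [|k IHk] Q PQ szQ.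
  exists Q => //; split=> // Q' [[Q'R _ _] _] QQ'; apply/seteqP; split=> // a Q'a.
  have : all (fun a => `[< Q a >]) wts.
    by rewrite all_count eqn_leq count_size /= -subn_eq0 -leqn0.
  by move=> /allP/(_ a (root_wts (Q'R _ Q'a)))/asboolP.
have [mQ|] := pselect (maximal_closed_subroot_system Q); first by exists Q.
move=> /not_andP[//|/existsNP[Q' /not_implyP[PQ' /not_implyP[QQ' neq]]]].
have [a Q'a Qa] : exists2 a, Q' a & ~ Q a.
  apply: contrapT => /forall2NP H; apply: neq; apply/seteqP; split=> // a Q'a.
  by have [//|/contrapT] := H a.
have [|Q2 mQ2 Q'Q2] := IHk Q' PQ'; last by exists Q2 => //; apply: subset_trans Q'Q2.
have aw : a \in wts by case: PQ' => -[Q'R _ _] _; apply/root_wts/Q'R.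
have szQ' : (size wts >= sz Q')%N by apply: count_size.
suff : (sz Q < sz Q')%N by lia.
rewrite /sz -!size_filter; apply: (uniq_leq_size (s1 := a :: _)) => [|c].
  rewrite /= filter_uniq ?undup_uniq// andbT mem_filter aw andbT.
  by apply/asboolP.
rewrite inE !mem_filter => /orP[/eqP->|/andP[/asboolP Qc ->]].
  by rewrite aw andbT; apply/asboolP.
rewrite andbT; apply/asboolP.
exact: QQ'.
Qed.

(** * Weight components in the affine algebra *)

Local Notation aff := (affine B).
Local Notation atens := (aff_tens B).
Implicit Types (t : set aff) (r m : int) (Z : hdual h -> int -> Prop).

Lemma affP (p q : aff) :
  (forall m, p.1.1 m = q.1.1 m) -> p.1.2 = q.1.2 -> p.2 = q.2 -> p = q.
Proof.
by case: p q => [[l c] d] [[l' c'] d'] /= ll' -> ->; rewrite (loopP ll').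
Qed.

Lemma loop_lie_tens0 x (l : loop L) m : [lie tens x 0, l] m = [lie x, l m].
Proof.
rewrite -[LHS]/(\sum_(k \in [set: int]) [lie tens x 0 k, l (m - k)]).
rewrite (fsum_tens (F := fun v k => [lie v, l (m - k)])); first by rewrite subr0.
by move=> k; rewrite lie0l.
Qed.

Lemma cocycle_tens0 x (l : loop L) : cocycle B (tens x 0) l = 0.
Proof.
rewrite /cocycle (fsum_tens (F := fun v k => k%:~R * B v (l (- k)))); first by rewrite mul0r.
by move=> k; rewrite Defs.form0l mulr0.
Qed.

Lemma deg_der_tens0 x : deg_der (tens x 0) = 0.
Proof. by rewrite deg_der_tens scale0r tens0. Qed.

Lemma aff_cartan_valE (H : aff_cartan h) :
  aff_cartan_val B H = (tens (vsval H.1.1) 0, H.1.2, H.2).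
Proof.
apply: affP => [m||] /=; last 2 first.
- by rewrite add0r scaler0 addr0 /= -[LHS]/(H.1.2 * 1) mulr1.
- by rewrite add0r scaler0 add0r -[LHS]/(H.2 * 1) mulr1.
by rewrite !scaler0 !addr0.
Qed.

Lemma cartan_lieE (H : aff_cartan h) (u : aff) :
  [lie aff_cartan_val B H, u] =
  ([lie tens (vsval H.1.1) 0, u.1.1] + (H.2 : K) *: deg_der u.1.1, 0, 0).
Proof.
rewrite aff_cartan_valE /lie /= /affine_lie /= deg_der_tens0 scaler0 subr0.
by rewrite cocycle_tens0.
Qed.

Lemma cartan_lie_loop (H : aff_cartan h) (u : aff) m :
  [lie aff_cartan_val B H, u].1.1 m =
  [lie vsval H.1.1, u.1.1 m] + ((H.2 : K) * m%:~R) *: u.1.1 m.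
Proof.
rewrite cartan_lieE.
rewrite -[LHS]/([lie tens (vsval H.1.1) 0, u.1.1] m + (H.2 : K) *: (m%:~R *: u.1.1 m)).
by rewrite loop_lie_tens0 scalerA.
Qed.

Lemma aff_tens_lie u v r m : [lie atens u r, atens v m] =
  (tens [lie u, v] (r + m), if r + m == 0 then r%:~R * B u v else 0, 0) :> aff.
Proof.
rewrite {1}/lie /= /affine_lie /= !scale0r subr0 addr0 cocycle_tens.
by rewrite {1}/lie /= loop_lie_tens.
Qed.

Lemma aff_tens_subspace t r : linear_subspace t ->
  linear_subspace [set v | t (atens v r)].
Proof.
move=> lt; have tZD c u v : atens (c *: u + v) r = c *: atens u r + atens v r.
  apply: affP => [m||] /=; rewrite ?scaler0 ?addr0//.
  rewrite -[RHS]/(c *: tens u r m + tens v r m) !tensE.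
  by case: eqP; rewrite ?scaler0 ?addr0.
split=> [|c u v tu tv] /=; last by rewrite tZD; apply: lt.2.
rewrite (_ : atens 0 r = 0); first exact: subspace0.
by apply: affP => // m; rewrite -[LHS]/(tens 0 r m) tensE if_same.
Qed.

Lemma aff_tens_sum (I : Type) (s : seq I) (F : I -> L) r :
  atens (\sum_(i <- s) F i) r = \sum_(i <- s) atens (F i) r.
Proof.
elim: s => [|i s IHs].
  rewrite !big_nil; apply: affP => // m.
  by rewrite -[LHS]/(tens 0 r m) tensE if_same.
rewrite !big_cons -IHs; apply: affP => [m||] /=; rewrite ?addr0//.
rewrite -[RHS]/(tens (F i) r m + tens (\sum_(j <- s) F j) r m) !tensE.
by case: eqP; rewrite ?addr0.
Qed.

(** Degree 0 is always listed because [regular_components] attaches c and d to the pair (0, 0);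
    [weights0] lists the weight 0 for the same reason. *)
Definition degrees (u : aff) : seq int := undup (0 :: loop_supp u.1.1).

Lemma aff_decomp (u : aff) : u = \sum_(r <- degrees u) atens (u.1.1 r) r +
  ((u.1.2 : K) *: aff_c B + (u.2 : K) *: aff_d B).
Proof.
have sumE (s : seq int) (F : int -> aff) :
    \sum_(r <- s) F r =
    (\sum_(r <- s) (F r).1.1, \sum_(r <- s) (F r).1.2, \sum_(r <- s) (F r).2).
  elim: s => [|r s IHs]; first by rewrite !big_nil.
  by rewrite !big_cons IHs.
rewrite sumE /=; apply: affP => [m||] /=; last 2 first.
- by rewrite big1_eq add0r scaler0 addr0 -[RHS]/(u.1.2 * 1) mulr1.
- by rewrite big1_eq add0r scaler0 add0r -[RHS]/(u.2 * 1) mulr1.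
rewrite !scaler0 !addr0 loop_sumE.
have [ms|ms] := boolP (m \in degrees u).
  rewrite (bigD1_seq m) ?undup_uniq//= eqxx big1 ?addr0// => r.
  by rewrite eq_sym => /negbTE->.
rewrite big1_seq => [|r /andP[_ rs]]; last first.
  by rewrite /=; case: eqP => // mr; rewrite mr rs in ms.
apply: loop_suppP; apply: contra ms => ms.
by rewrite mem_undup inE ms orbT.
Qed.

Definition weights0 : seq (hdual h) := undup (0 :: wts).

Lemma vproj_sum0 v : v = \sum_(a <- weights0) vproj a v.
Proof.
rewrite {1}[v]coord_eb; apply: sum_fibers; first exact: undup_uniq.
by move=> i; rewrite mem_undup inE mem_undup codom_f orbT.
Qed.

Lemma vproj_notin a v : a \notin weights0 -> vproj a v = 0.
Proof.
move=> aw; apply: contrapT => va; case/negP: aw; rewrite mem_undup inE.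
by rewrite (mem_wts (vproj_root a v) va) orbT.
Qed.

(** The Cartan subalgebra separates the pairs (a, r), with d distinguishing the degrees. Only at (0,
    0) do h, c and d share a weight, so that component stays in one piece. *)
Lemma regular_components t (u : aff) : regular_subalgebra h t -> t u ->
  (forall a r, a <> 0 \/ r <> 0 -> t (atens (vproj a (u.1.1 r)) r)) /\
  t (atens (vproj 0 (u.1.1 0)) 0 + ((u.1.2 : K) *: aff_c B + (u.2 : K) *: aff_d B)).
Proof.
move=> [[lt tL] tH] tu; pose s := [seq (a, r) | a <- weights0, r <- degrees u].
pose cd : aff := (u.1.2 : K) *: aff_c B + (u.2 : K) *: aff_d B.
pose f (j : hdual h * int) : aff :=
  atens (vproj j.1 (u.1.1 j.2)) j.2 + (if j == (0, 0) then cd else 0).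
have s0 : (0, 0) \in s.
  by apply/allpairsP; exists (0, 0); rewrite /= !mem_undup !inE !eqxx.
have us : uniq s by apply: allpairs_uniq; rewrite ?undup_uniq// => -[? ?] [? ?].
have uE : u = \sum_(j <- s) f j.
  rewrite {1}[u]aff_decomp big_split /=; congr (_ + _); last first.
    by rewrite (bigD1_seq (0, 0))//= eqxx big1 ?addr0// => j /negbTE->.
  rewrite big_allpairs exchange_big; apply: eq_bigr => r _.
  by rewrite {1}(vproj_sum0 (u.1.1 r)) aff_tens_sum.
have fs j : j \in s -> t (f j).
  move: j; apply: (eigen_components lt (I := aff_cartan h) (s := s) (u := f)
    (A := fun H : aff_cartan h => lie (aff_cartan_val B H))
    (wt := fun j (H : aff_cartan h) => (j.1 H.1.1 : K) + (H.2 : K) * j.2%:~R)) => //.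
  - by move=> H'; apply: lie_linearr.
  - move=> j H'; apply: affP => [m||].
    + rewrite cartan_lie_loop.
      rewrite -[RHS]/(((j.1 H'.1.1 : K) + (H'.2 : K) * j.2%:~R) *: (f j).1.1 m).
      have -> : (f j).1.1 m = tens (vproj j.1 (u.1.1 j.2)) j.2 m.
        rewrite -[LHS]/(tens (vproj j.1 (u.1.1 j.2)) j.2 m + (if _ then _ else _ : aff).1.1 m).
        case: ifP => _; last exact: addr0.
        by rewrite -[RHS]addr0; congr (_ + _); rewrite /= !scaler0 addr0.
      rewrite tensE; case: eqP => [->|_]; last by rewrite lie0r !scaler0 addr0.
      by rewrite vproj_root -scalerDl.
    + rewrite cartan_lieE /=; case: eqP => [->|_]; last by rewrite addr0 scaler0.
      by rewrite zero_lfunE mulr0 addr0 scale0r.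
    + rewrite cartan_lieE /=; case: eqP => [->|_]; last by rewrite addr0 scaler0.
      by rewrite zero_lfunE mulr0 addr0 scale0r.
  - move=> [a r] [b m] _ _ /= jj'; congr (_, _).
      apply/lfunP => H; have := jj' (H, 0, 0).
      by rewrite /= !mul0r !addr0.
    have /= := jj' (0, 0, 1); rewrite !linear0 !add0r !mul1r.
    by move/eqP; rewrite eqr_int => /eqP.
  - by rewrite -uE.
split=> [a r ar|]; last by have := fs _ s0; rewrite /f eqxx.
have [ars|] := boolP ((a, r) \in s).
  have := fs _ ars; rewrite /f /=; case: eqP => [[a0 r0]|_]; last by rewrite addr0.
  by case: ar; rewrite ?a0 ?r0.
move=> ns; suff -> : vproj a (u.1.1 r) = 0 by apply: (subspace0 (aff_tens_subspace r lt)).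
have [aw|/vproj_notin//] := boolP (a \in weights0).
rewrite loop_suppP ?vproj0//; apply: contra ns => rs.
by apply/allpairsP; exists (a, r); rewrite /= aw mem_undup inE rs orbT.
Qed.

(* [Z 0 r] governs the part of degree r of the loop algebra of h. *)
Definition graded_sub Z : set aff :=
  [set u : aff | forall a r, Z a r \/ vproj a (u.1.1 r) = 0].

Lemma graded_sub_subspace Z : linear_subspace (graded_sub Z).
Proof.
split=> [a r|c u v Zu Zv a r]; first by right; apply: vproj0.
have [|Zau] := Zu a r; first by left.
have [|Zav] := Zv a r; first by left.
right; rewrite -[X in vproj a X]/(c *: u.1.1 r + v.1.1 r) vproj_linear Zau Zav.
by rewrite scaler0 addr0.
Qed.

Lemma graded_sub_c Z : graded_sub Z (aff_c B).
Proof. by move=> a r; right; apply: vproj0. Qed.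

Lemma graded_sub_d Z : graded_sub Z (aff_d B).
Proof. by move=> a r; right; apply: vproj0. Qed.

Lemma graded_sub_tens Z a r v : Z a r -> root_space a v -> graded_sub Z (atens v r).
Proof.
move=> Zar av b m /=.
case: eqP => [->|_]; last by right; apply: vproj0.
have [<-|ab] := pselect (a = b); first by left.
by right; apply: vproj_eq0 av ab.
Qed.

Lemma graded_sub_ind Z t : linear_subspace t -> t (aff_c B) -> t (aff_d B) ->
  (forall a r v, Z a r -> root_space a v -> t (atens v r)) ->
  graded_sub Z `<=` t.
Proof.
move=> lt tc td tZ u Zu; rewrite [u]aff_decomp; apply: (subspaceD lt).
  apply: (subspace_sum lt) => r _ _; rewrite [u.1.1 r]vproj_sum aff_tens_sum.
  apply: (subspace_sum lt) => a _ _.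
  have [Zar|->] := Zu a r; first exact: tZ Zar (vproj_root _ _).
  exact: (subspace0 (aff_tens_subspace r lt)).
by apply: (subspaceD lt); apply: (subspaceZ lt).
Qed.

Lemma aff_c_central (u : aff) : [lie aff_c B, u] = 0.
Proof.
rewrite /lie /= /affine_lie /= lie0l scale0r deg_der0 scaler0 subr0 addr0.
by rewrite cocycle0l.
Qed.

Lemma aff_d_lie (u : aff) : [lie aff_d B, u] = (deg_der u.1.1, 0, 0).
Proof.
rewrite /lie /= /affine_lie /= lie0l scale1r deg_der0 scaler0 subr0 add0r.
by rewrite cocycle0l.
Qed.

Lemma graded_sub_d_lie Z (u : aff) : graded_sub Z u -> graded_sub Z [lie aff_d B, u].
Proof.
move=> Zu a r; have [|Zau] := Zu a r; [by left|right].
rewrite aff_d_lie /= -[X in vproj a X]addr0 vproj_linear Zau.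
by rewrite scaler0 vproj0 addr0.
Qed.

(** Only nonzero brackets impose a condition, which makes a + b a weight whenever the condition is
    used. *)
Definition graded_closed Z : Prop := forall a b u v r m, Z a r -> Z b m ->
  root_space a u -> root_space b v -> [lie u, v] <> 0 -> Z (a + b) (r + m).

Lemma graded_sub_lie Z : graded_closed Z -> lie_subalgebra (graded_sub Z).
Proof.
move=> Zcl; split; first exact: graded_sub_subspace.
have lZ := graded_sub_subspace Z.
have linl (p : aff) : linear_subspace [set q : aff | graded_sub Z [lie q, p]].
  split=> [|c q q' Zq Zq'] /=; first by rewrite lie0l; apply: subspace0.
  by rewrite lieDl lieZl; apply: (subspaceD lZ); [exact: (subspaceZ lZ)|].
have linr (p : aff) : linear_subspace [set q : aff | graded_sub Z [lie p, q]].
  split=> [|c q q' Zq Zq'] /=; first by rewrite lie0r; apply: subspace0.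
  rewrite (lieDr p (c *: q) q') (lieZr c p q).
  by apply: (subspaceD lZ); [exact: (subspaceZ lZ)|].
have ZN p q : graded_sub Z [lie q, p] -> graded_sub Z [lie p, q].
  by move=> Zqp; rewrite lieC -scaleN1r; apply: (subspaceZ lZ).
move=> p q Zp Zq; move: p Zp; apply: (graded_sub_ind (linl q)) => /=.
- by rewrite aff_c_central; apply: subspace0.
- exact: graded_sub_d_lie.
move=> a r u Zar au; move: q Zq; apply: (graded_sub_ind (linr _)) => /=.
- by apply: ZN; rewrite aff_c_central; apply: subspace0.
- by apply/ZN/graded_sub_d_lie/(graded_sub_tens Zar).
(* The multiple of c in the bracket is invisible to [graded_sub], which tests only the loop part. *)
move=> b m v Zbm bv; rewrite aff_tens_lie.
have [uv|uv] := pselect ([lie u, v] = 0).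
  move=> c k; right; rewrite /= uv if_same; exact: vproj0.
exact: (graded_sub_tens (Zcl _ _ _ _ _ _ Zar Zbm au bv uv) (root_space_lie au bv)).
Qed.

Lemma graded_sub_cartan Z (H : aff_cartan h) : Z 0 0 -> graded_sub Z (aff_cartan_val B H).
Proof.
move=> Z0; rewrite aff_cartan_valE.
by apply: (graded_sub_tens Z0); apply/root_space0/subvsP.
Qed.

Lemma graded_sub_regular Z : Z 0 0 -> graded_closed Z ->
  regular_subalgebra h (graded_sub Z).
Proof.
move=> Z0 Zcl; have [lZ ZL] := graded_sub_lie Zcl; split=> // H u Zu.
by apply: ZL Zu; apply: graded_sub_cartan.
Qed.

(** * Affine roots as pairs of a weight and a degree *)

Definition deg_root a r : Prop := fin_roots a \/ a = 0 /\ r <> 0.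

Definition occurs t a r : Prop := exists v, [/\ root_space a v, v <> 0 & t (atens v r)].

Definition deg_weight a r : aff_hdual h := extend a + delta h *~ r.

Lemma deg_weightE a r (H : aff_cartan h) :
  deg_weight a r H = (a H.1.1 : K) + (H.2 : K) * r%:~R :> K.
Proof.
rewrite add_lfunE extendE -scaler_int scale_lfunE deltaE; congr (_ + _).
exact: mulrC.
Qed.

Lemma deg_weightN a r : deg_weight (- a) (- r) = - deg_weight a r.
Proof.
apply/lfunP => H; rewrite opp_lfunE [LHS]deg_weightE [in RHS]deg_weightE.
by rewrite opp_lfunE mulrNz mulrN opprD.
Qed.

Lemma aff_rootsP (l : aff_hdual h) :
  aff_roots l <-> exists a r, deg_root a r /\ l = deg_weight a r.
Proof.
split=> [[[a [r [ra ->]]]|[r [r0 ->]]]|[a [r [[ra|[-> r0]] ->]]]].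
- by exists a, r; split=> //; left.
- exists 0, r; split; first by right.
  apply/lfunP => H; rewrite [RHS]deg_weightE zero_lfunE add0r.
  by rewrite -scaler_int scale_lfunE deltaE; apply: mulrC.
- by left; exists a, r.
right; exists r; split=> //; apply/lfunP => H; rewrite [LHS]deg_weightE zero_lfunE add0r.
by rewrite -scaler_int scale_lfunE deltaE; apply: mulrC.
Qed.

Lemma deg_root_neq0 a r : deg_root a r -> exists H : aff_cartan h, deg_weight a r H <> 0.
Proof.
move=> ar; apply: contrapT => /forallNP nz.
have {}nz (H : aff_cartan h) : (a H.1.1 : K) + (H.2 : K) * r%:~R = 0.
  by rewrite -deg_weightE; apply: contrapT; apply: nz.
have a0 : a = 0.
  apply/lfunP => H; have := nz (H, 0, 0); rewrite /= mul0r addr0 => ->.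
  by rewrite zero_lfunE.
case: ar => [[/(_ a0)//]|[_]]; apply.
have /= := nz (0, 0, 1); rewrite linear0 add0r mul1r => /eqP.
by rewrite intr_eq0 => /eqP.
Qed.

(** The eigenvalue of d isolates the degree; the coordinates on c and d vanish because brackets with
    the Cartan subalgebra have none and the weight is nonzero. *)
Lemma aff_root_spaceP a r (u : aff) : deg_root a r ->
  aff_root_space (deg_weight a r) u <-> exists2 v, root_space a v & u = atens v r.
Proof.
move=> ar; split=> [lu|[v av ->] H]; last first.
  apply: affP => [m||]; last 2 first.
  - by rewrite cartan_lieE /= scaler0.
  - by rewrite cartan_lieE /= scaler0.
  rewrite cartan_lie_loop -[RHS]/(_ *: (atens v r).1.1 m) deg_weightE /=.
  by case: eqP => [->|_]; rewrite ?lie0r ?scaler0 ?addr0// av -scalerDl.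
have [H0 /eqP lH0] := deg_root_neq0 ar.
have luE (H : aff_cartan h) m : ((a H.1.1 : K) + (H.2 : K) * r%:~R) *: u.1.1 m =
    [lie vsval H.1.1, u.1.1 m] + ((H.2 : K) * m%:~R) *: u.1.1 m.
  by rewrite -cartan_lie_loop lu -deg_weightE.
have ur m : m <> r -> u.1.1 m = 0.
  move=> mr; have := luE (0, 0, 1) m; rewrite /= !linear0 lie0l !add0r !mul1r.
  move=> /eqP; rewrite -subr_eq0 -scalerBl scaler_eq0 subr_eq0 eqr_int.
  by rewrite eq_sym => /orP[/eqP/mr//|/eqP].
exists (u.1.1 r).
  move=> H; have /= := luE (H, 0, 0) r; rewrite !mul0r !addr0 scale0r addr0.
  by move=> ->.
apply: affP => [m||] /=.
- by case: eqP => [->//|/ur].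
- have /(congr1 (fun p : aff => p.1.2)) := lu H0; rewrite cartan_lieE /= => /esym/eqP.
  by rewrite scaler_eq0 (negbTE lH0) => /eqP.
- have /(congr1 (fun p : aff => p.2)) := lu H0; rewrite cartan_lieE /= => /esym/eqP.
  by rewrite scaler_eq0 (negbTE lH0) => /eqP.
Qed.

Lemma atens_eq0 v r : atens v r = 0 <-> v = 0.
Proof.
split=> [/(congr1 (fun p : aff => p.1.1 r))/=|->]; first by rewrite eqxx.
by apply: affP => // m; rewrite -[LHS]/(tens 0 r m) tensE if_same.
Qed.

Lemma roots_of_deg_weight t a r : deg_root a r ->
  roots_of t (deg_weight a r) <-> occurs t a r.
Proof.
move=> ar; split=> [[_ [u [/(aff_root_spaceP u ar)[v av ->] tv] v0]]|[v [av v0 tv]]].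
  by exists v; split=> // v0'; apply: v0; apply/atens_eq0.
split; first by apply/aff_rootsP; exists a, r.
exists (atens v r); last by move=> /atens_eq0.
by split=> //; apply/(aff_root_spaceP _ ar); exists v.
Qed.

Lemma deg_rootN a r : deg_root a r -> deg_root (- a) (- r).
Proof.
case=> [ra|[-> r0]]; [by left; apply: root_opp|right; rewrite oppr0; split=> //].
by move/eqP; rewrite oppr_eq0 => /eqP.
Qed.

Lemma symmetric_subsetP t : symmetric_subset h t <->
  forall a r, deg_root a r -> occurs t a r -> occurs t (- a) (- r).
Proof.
split=> [symt a r ar /(roots_of_deg_weight t ar)|tN].
  rewrite {1}symt => -[l tl lE]; apply/(roots_of_deg_weight t (deg_rootN ar)).
  by rewrite deg_weightN -lE opprK.
have rN (l : aff_hdual h) : roots_of t l -> roots_of t (- l).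
  move=> tl; have [al _] := tl; have [a [r [ar lE]]] := (aff_rootsP l).1 al.
  move: tl; rewrite lE -deg_weightN => /(roots_of_deg_weight t ar)/(tN _ _ ar) occ.
  exact/(roots_of_deg_weight t (deg_rootN ar)).
apply/seteqP; split=> [l /rN tl|_ [l /rN tl <-]//].
by exists (- l) => //; rewrite opprK.
Qed.

Lemma occurs_graded_sub Z a r : occurs (graded_sub Z) a r -> Z a r.
Proof.
by move=> [v [av v0 /(_ a r)[//|]]]; rewrite /= eqxx vproj_id.
Qed.

Lemma graded_sub_symmetric Z :
  (forall a r, deg_root a r -> Z a r -> Z (- a) (- r)) ->
  symmetric_subset h (graded_sub Z).
Proof.
move=> ZN; apply/symmetric_subsetP => a r ar occ.
have Zar := ZN _ _ ar (occurs_graded_sub occ); case: occ => v [av v0 _].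
have [v' av' v'0] : exists2 v', root_space (- a) v' & v' <> 0.
  have [v' av' B1] := root_dual av v0; exists v' => // v'0.
  by move/eqP: B1; rewrite v'0 form0r eq_sym oner_eq0.
by exists v'; split=> //; apply: graded_sub_tens Zar av'.
Qed.

Lemma graded_sub_proper Z a r : fin_roots a -> ~ Z a r -> graded_sub Z <> setT.
Proof.
move=> [_ [v av v0]] nZ ZT; apply: nZ; apply: occurs_graded_sub; exists v.
by split=> //; rewrite ZT.
Qed.

(** Every component of an element of t lies in t except the one at (0, 0), which [Z 0 0] absorbs. *)
Lemma sub_graded_sub Z t : regular_subalgebra h t -> Z 0 0 ->
  (forall a r, deg_root a r -> occurs t a r -> Z a r) -> t `<=` graded_sub Z.
Proof.
move=> rt Z0 tZ u tu a r; have [va|va] := pselect (vproj a (u.1.1 r) = 0); first by right.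
left; have av := vproj_root a (u.1.1 r).
have [[a0 r0]|ar] := pselect (a = 0 /\ r = 0); first by rewrite a0 r0.
have dar : deg_root a r.
  have [a0|a0] := pselect (a = 0); first by right; split=> // r0; apply: ar.
  by left; split=> //; exists (vproj a (u.1.1 r)).
apply: tZ => //; exists (vproj a (u.1.1 r)); split=> //.
apply: (regular_components rt tu).1.
by case/not_andP: ar; [left|right].
Qed.

Lemma aff_tens_lie_sub t u v r m : linear_subspace t -> t (aff_c B) ->
  t [lie atens u r, atens v m] -> t (atens [lie u, v] (r + m)).
Proof.
move=> lt tc; rewrite aff_tens_lie; set c := (if _ then _ else _) => tuv.
suff -> : atens [lie u, v] (r + m) = (tens [lie u, v] (r + m), c, 0) - c *: aff_c B :> aff.
  by apply: (subspaceB lt) => //; apply: (subspaceZ lt).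
apply: affP => [k||] /=; rewrite ?scaler0 ?subr0//.
by rewrite -[c *: _]/(c * 1) mulr1 subrr.
Qed.

(** * Generation by real root vectors and the derived algebra *)

(** The v with v t^r in t for all r form a nonzero ideal of L. Then the bracket of u t and v t^-1
    with B(u, v) = 1 yields c. *)
Lemma root_vectors_generate t : regular_subalgebra h t ->
  (forall a r v, fin_roots a -> root_space a v -> t (atens v r)) ->
  (forall v r, t (atens v r)) /\ t (aff_c B).
Proof.
move=> [[lt tL] tH] troot.
have tall v : forall r, t (atens v r).
  move: v; apply: (ideal_full simL (P := fun v => forall r, t (atens v r))).
  - split=> [r|c u v tu tv r]; first exact: (subspace0 (aff_tens_subspace r lt)).
    by apply: (aff_tens_subspace r lt).2.
  - move=> x y ty r; move: x; apply: (lie_ideal_ind (aff_tens_subspace r lt)) => i /=.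
    have yr : t [lie atens e`_i 0, atens y r].
      have [wi|ri] := weight_cases i; last by apply: tL => //; apply: troot (ew i).
      have eh : e`_i \in h by apply/root_space0; rewrite -wi.
      have := tH (vsproj h e`_i, 0, 0) _ (ty r).
      by rewrite aff_cartan_valE /= vsprojK.
    by move: yr; rewrite aff_tens_lie add0r mul0r if_same.
  - have [a [a0 [v av v0]]] := root_ex; exists v => // r.
    by apply: (troot a) => //; split=> //; exists v.
split=> //.
have [a [a0 [u au u0]]] := root_ex; have [v av Buv] := root_dual au u0.
have := tL _ _ (tall u 1) (tall v (-1)); rewrite aff_tens_lie subrr eqxx Buv mulr1 => tuv.
have -> : aff_c B = (tens [lie u, v] 0, 1, 0) - atens [lie u, v] 0 :> aff.
  by apply: affP => [k||] /=; rewrite ?subrr ?subr0.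
exact: (subspaceB lt).
Qed.

Lemma regular_full t : regular_subalgebra h t ->
  (forall H : aff_cartan h, t (aff_cartan_val B H)) ->
  (forall a r v, fin_roots a -> root_space a v -> t (atens v r)) -> t = setT.
Proof.
move=> rt ct troot; have [tall tc] := root_vectors_generate rt troot.
apply/seteqP; split=> // u _; have [[lt _] _] := rt.
have td : t (aff_d B).
  suff -> : aff_d B = aff_cartan_val B ((0, 0, 1) : aff_cartan h) by apply: ct.
  rewrite aff_cartan_valE /=.
  by apply: affP => // k; rewrite -[RHS]/(tens _ _ k) tensE linear0 if_same.
rewrite [u]aff_decomp; apply: (subspaceD lt).
  by apply: (subspace_sum lt).
by apply: (subspaceD lt); apply: (subspaceZ lt).
Qed.

Lemma deg0_subspace : linear_subspace [set u : aff | u.2 = 0].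
Proof.
by split=> // c p q /= p0 q0; rewrite p0 q0 scaler0 addr0.
Qed.

Lemma sub_deg0 t : linear_subspace t -> (forall v r, t (atens v r)) -> t (aff_c B) ->
  [set u : aff | u.2 = 0] `<=` t.
Proof.
move=> lt tall tc u /= u0; rewrite [u]aff_decomp u0 scale0r addr0.
by apply: (subspaceD lt); [apply: (subspace_sum lt)|apply: (subspaceZ lt)].
Qed.

(** A root vector is a multiple of its bracket with some H on which the root is nonzero, so
    [root_vectors_generate] applies. *)
Lemma derived_algebraE : derived_algebra aff = [set u : aff | u.2 = 0].
Proof.
apply/seteqP; split.
  by apply: lspan_min; [exact: deg0_subspace|move=> _ [p [q ->]]].
have lD := lspan_subspace [set z : aff | exists x y : aff, z = [lie x, y]].
have DL (p q : aff) : derived_algebra aff [lie p, q] by apply: subset_lspan; exists p, q.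
suff [Dall Dc] : (forall v r, derived_algebra aff (atens v r)) /\ derived_algebra aff (aff_c B).
  exact: sub_deg0.
apply: root_vectors_generate; first by split=> // H u _; apply: DL.
move=> a r v ra av; have a0 := fin_root_neq0 ra.
have [H /eqP aH] : exists H, a H <> 0.
  apply: contrapT => /forallNP aH; case/eqP: a0; apply/lfunP => H.
  by rewrite zero_lfunE; apply: contrapT; apply: aH.
apply: (subspaceZK (aff_tens_subspace r lD) aH); rewrite /= -av.
have := DL (atens (vsval H) 0) (atens v r).
by rewrite aff_tens_lie add0r mul0r if_same.
Qed.

Lemma derived_algebra_lie : lie_subalgebra (derived_algebra aff).
Proof. by rewrite derived_algebraE; split; first exact: deg0_subspace. Qed.

Lemma deg0_codim1 t : linear_subspace t -> [set u : aff | u.2 = 0] `<=` t ->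
  t = [set u : aff | u.2 = 0] \/ t = setT.
Proof.
move=> lt t0; have [tE|] := pselect (t `<=` [set u : aff | u.2 = 0]).
  by left; apply/seteqP.
move=> /existsNP[p /not_implyP[tp /eqP p0]]; right; apply/seteqP; split=> // q _.
rewrite -[q](subrK ((q.2 / p.2) *: p)); apply: (subspaceD lt); last exact: (subspaceZ lt).
by apply: t0; rewrite /= -[_ *: _]/(q.2 / p.2 * p.2) divfK// subrr.
Qed.

Lemma derived_algebra_maximal : maximal_symmetric_regular h (derived_algebra aff).
Proof.
have DE := derived_algebraE.
split=> [|t [[[lt _] _] _ tT] Dt]; last first.
  by rewrite DE in Dt *; have [|/tT] := deg0_codim1 lt Dt.
split.
- split; first exact: derived_algebra_lie.
  by move=> H u _; rewrite DE cartan_lieE.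
- rewrite DE; apply/symmetric_subsetP => a r ar [v [av v0 _]].
  have [v' av' Bvv] := root_dual av v0; exists v'; split=> // v'0.
  by move/eqP: Bvv; rewrite v'0 form0r eq_sym oner_eq0.
- rewrite DE => ET; have : [set u : aff | u.2 = 0] (aff_d B) by rewrite ET.
  by move/eqP; rewrite oner_eq0.
Qed.

Lemma cartan_val_linear c (H H' : aff_cartan h) :
  aff_cartan_val B (c *: H + H') = c *: aff_cartan_val B H + aff_cartan_val B H'.
Proof.
rewrite !aff_cartan_valE; apply: affP => // m.
rewrite -[LHS]/(tens _ 0 m) -[RHS]/(c *: tens (vsval H.1.1) 0 m + tens (vsval H'.1.1) 0 m).
by rewrite !tensE; case: eqP; rewrite ?scaler0 ?addr0.
Qed.

Lemma cartan_val_abelian (H H' : aff_cartan h) :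
  [lie aff_cartan_val B H, aff_cartan_val B H'] = 0.
Proof.
rewrite cartan_lieE aff_cartan_valE /= deg_der_tens0 scaler0 addr0.
apply: affP => // m.
rewrite -[LHS]/([lie tens (vsval H.1.1) 0, tens (vsval H'.1.1) 0] m) loop_lie_tens0 tensE.
by case: eqP; rewrite ?lie0r// (cartan_abelian Ch) ?subvsP.
Qed.

(** The Cartan element lives at (0, 0), so projecting to (a, r) removes it: adding the Cartan
    subalgebra to t creates no new roots. *)
Lemma add_cartan_occurs t a r v (H : aff_cartan h) : regular_subalgebra h t ->
  deg_root a r -> root_space a v -> t (atens v r - aff_cartan_val B H) -> t (atens v r).
Proof.
move=> rt ar av tvH; have [tc _] := regular_components rt tvH.
have [r0|r0] := eqVneq r 0.
  have ra : fin_roots a by case: ar => // -[_]; rewrite r0.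
  have := tc a r (or_introl ra.1).
  rewrite aff_cartan_valE /= -[X in vproj a X]/(tens v r r - tens (vsval H.1.1) 0 r).
  have -> : tens v r r - tens (vsval H.1.1) 0 r = - 1 *: vsval H.1.1 + v.
    by rewrite !tensE eqxx r0 eqxx scaleN1r addrC.
  rewrite vproj_linear (vproj_id av) (vproj_eq0 (b := 0)) ?scaler0 ?add0r//.
    by apply/root_space0/subvsP.
  by move/esym/ra.1.
have := tc a r (or_intror (elimN eqP r0)).
rewrite aff_cartan_valE /= -[X in vproj a X]/(tens v r r - tens (vsval H.1.1) 0 r).
by rewrite !tensE eqxx (negbTE r0) subr0 vproj_id.
Qed.

Lemma maximal_contains_cartan t : maximal_symmetric_regular h t ->
  t = derived_algebra aff \/ forall H : aff_cartan h, t (aff_cartan_val B H).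
Proof.
move=> [[rt st tT] tmax]; have [[lt tL] tH] := rt.
pose t' : set aff := [set p | exists H : aff_cartan h, t (p - aff_cartan_val B H)].
have cval0 : aff_cartan_val B (0 : aff_cartan h) = 0.
  by have := cartan_val_linear (-1) (0 : aff_cartan h) 0; rewrite scaler0 addr0 scaleN1r addNr.
have tt' : t `<=` t' by move=> p tp; exists 0; rewrite cval0 subr0.
have lt' : linear_subspace t'.
  split=> [|c p q [H pH] [H' qH]]; first by exists 0; rewrite cval0 subr0; apply: subspace0.
  exists (c *: H + H'); rewrite cartan_val_linear opprD addrACA -scalerBr.
  by apply: (subspaceD lt) => //; apply: (subspaceZ lt).
(* The Cartan subalgebra normalizes t and is abelian, so the sum is closed under brackets. *)
have rt' : regular_subalgebra h t'.
  have t'H (H : aff_cartan h) p : t' p -> t' [lie aff_cartan_val B H, p].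
    move=> [H' pH]; exists 0; rewrite cval0 subr0.
    have -> : [lie aff_cartan_val B H, p] = [lie aff_cartan_val B H, p - aff_cartan_val B H'].
      by rewrite lieDr lieNr cartan_val_abelian subr0.
    exact: tH.
  split=> //; split=> // p q [H pH] t'q.
  rewrite -[p](subrK (aff_cartan_val B H)) lieDl; apply: (subspaceD lt'); last exact: t'H.
  case: t'q => H' qH; exists 0; rewrite cval0 subr0.
  rewrite -[q](subrK (aff_cartan_val B H')) lieDr; apply: (subspaceD lt); first exact: tL.
  by rewrite lieC -scaleN1r; apply: (subspaceZ lt); apply: tH.
have occt' a r : deg_root a r -> occurs t' a r -> occurs t a r.
  move=> ar [v [av v0 [H tv]]]; exists v; split=> //.
  exact: add_cartan_occurs rt ar av tv.
have st' : symmetric_subset h t'.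
  apply/symmetric_subsetP => a r ar /(occt' _ _ ar) occ.
  have [v [av v0 tv]] := (symmetric_subsetP t).1 st _ _ ar occ.
  by exists v; split=> //; apply: tt'.
have [t'T|t'T] := pselect (t' = setT); last first.
  right => H; rewrite -(tmax t') //; exists H; rewrite subrr; exact: subspace0.
left; have troot a r v : fin_roots a -> root_space a v -> t (atens v r).
  move=> ra av; have : t' (atens v r) by rewrite t'T.
  by case=> H; apply: add_cartan_occurs => //; left.
have [tall tc] := root_vectors_generate rt troot.
have [->|//] := deg0_codim1 lt (sub_deg0 lt tall tc).
by rewrite derived_algebraE.
Qed.

(** * Subalgebras containing the Cartan subalgebra *)

Lemma occurs_tens t a r v : linear_subspace t -> fin_roots a -> occurs t a r ->
  root_space a v -> t (atens v r).
Proof.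
move=> lt ra [u [au u0 tu]] av; have [c ->] := root_space_line ra au u0 av.
exact: (subspaceZ (aff_tens_subspace r lt)).
Qed.

Lemma sub_occurs t t' a r : t `<=` t' -> occurs t a r -> occurs t' a r.
Proof. by move=> tt' [v [av v0 /tt' tv]]; exists v. Qed.

Section CartanSubalgebras.
Variable t : set aff.
Hypotheses (rt : regular_subalgebra h t) (st : symmetric_subset h t).
Hypothesis ct : forall H : aff_cartan h, t (aff_cartan_val B H).

Let lt : linear_subspace t. Proof. by case: rt => -[]. Qed.
Let tL p q : t p -> t q -> t [lie p, q]. Proof. by case: rt => -[_ +] _; apply. Qed.

Let tc : t (aff_c B).
Proof.
suff -> : aff_c B = aff_cartan_val B ((0, 1, 0) : aff_cartan h) by apply: ct.
rewrite aff_cartan_valE; apply: affP => // k.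
by rewrite -[RHS]/(tens _ _ k) tensE linear0 if_same.
Qed.

Lemma occurs_lie a b r m : fin_roots a -> fin_roots b -> fin_roots (a + b) ->
  occurs t a r -> occurs t b m -> occurs t (a + b) (r + m).
Proof.
move=> ra rb rab [u [au u0 tu]] [v [bv v0 tv]]; exists [lie u, v]; split.
- exact: root_space_lie.
- exact: (lie_roots_neq0 ra rb rab au bv).
- by apply: (aff_tens_lie_sub lt tc); apply: tL.
Qed.

Lemma occurs_opp a r : fin_roots a -> occurs t a r -> occurs t (- a) (- r).
Proof. by move=> ra; apply: (symmetric_subsetP t).1 => //; left. Qed.

Lemma occurs_coroot a r m : fin_roots a -> occurs t a r -> occurs t a m ->
  t (atens (vsval (coroot a)) (r - m)).
Proof.
move=> ra tr /(occurs_opp ra) tm; have [x [y [ax ay -> _]]] := coroot_tripleT ra.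
apply: (aff_tens_lie_sub lt tc); apply: tL; first exact: occurs_tens tr ax.
exact: occurs_tens (root_opp ra) tm ay.
Qed.

Lemma occurs_shift b H r m : t (atens (vsval H) r) -> b H <> 0 ->
  occurs t b m -> occurs t b (m + r).
Proof.
move=> tH /eqP bH [v [bv v0 tv]]; exists v; split=> //; rewrite addrC.
apply: (subspaceZK (aff_tens_subspace _ lt) bH); rewrite /= -bv.
by apply: (aff_tens_lie_sub lt tc); apply: tL.
Qed.

(** [S] is the group of periods of the set of degrees of a. It contains all their differences
    because a(h_a) = 2, so a nonempty set of degrees is a single coset of it. *)
Lemma occurs_step a : fin_roots a -> exists k : nat, forall r m,
  occurs t a r -> occurs t a m <-> (k%:Z %| m - r)%Z.
Proof.
move=> ra; have aa : a (coroot a) <> 0.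
  by rewrite root_coroot// => /eqP; rewrite pnatr_eq0.
pose S r := forall m, occurs t a m -> occurs t a (m + r) /\ occurs t a (m - r).
have SP r m : occurs t a r -> occurs t a m <-> S (m - r).
  move=> tr; split=> [tm k tk|/(_ r tr)[+ _]]; last by rewrite addrC subrK.
  split; first exact: occurs_shift (occurs_coroot ra tm tr) aa tk.
  by rewrite opprB; apply: occurs_shift (occurs_coroot ra tr tm) aa tk.
have [k kP] : exists k : nat, forall r, S r <-> (k%:Z %| r)%Z.
  apply: int_subgroup => [m tm|r r' Sr Sr' m tm]; first by split; rewrite ?addr0 ?subr0.
  split; first by rewrite addrA; apply: (Sr' _ (Sr _ tm).1).2.
  by rewrite opprB addrCA [r' + _]addrC; apply: (Sr' _ (Sr _ tm).2).1.
by exists k => r m tr; apply: (iff_trans (SP _ _ tr)).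
Qed.

(** Transport along b(h_a) <> 0 uses both pairings: differences of degrees of b shift those of a, so
    k divides them; multiples of k are differences of degrees of a, and these shift the degrees of
    b. *)
Lemma common_step : (forall a, fin_roots a -> exists r, occurs t a r) ->
  exists k : nat, forall a, fin_roots a -> forall r m,
    occurs t a r -> occurs t a m <-> (k%:Z %| m - r)%Z.
Proof.
move=> tex; have [a0 ra0] := root_ex; have [k kP] := occurs_step ra0; exists k.
apply: (connected_roots (P := [set a | forall r m,
  occurs t a r -> occurs t a m <-> (k%:Z %| m - r)%Z])); last by exists a0.
move=> a b aP ra rb ba r m tr; have ab := coroot_pairing_neq0 ra rb ba.
have [ra' tra'] := tex _ ra; split=> [tm|mr].
  have := occurs_shift (occurs_coroot rb tm tr) ab tra'.
  by move/(aP _ _ tra'); rewrite addrC addKr.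
have tam : occurs t a (ra' + (m - r)) by apply/(aP _ _ tra'); rewrite addrC addKr.
have := occurs_shift (occurs_coroot ra tam tra') ba tr.
by rewrite [ra' + _]addrC addrK [r + _]addrC subrK.
Qed.

Lemma occurs_full : (forall a, fin_roots a -> forall r, occurs t a r) -> t = setT.
Proof.
move=> tall; apply: (regular_full rt ct) => a r v ra.
exact: (occurs_tens lt ra (tall _ ra r)).
Qed.

(** Stated for any divisor k of the differences, so that it serves both the exact step and a prime
    divisor of it. *)
Lemma step_occurs0 k r : (forall a, fin_roots a -> exists r, occurs t a r) ->
  (forall a, fin_roots a -> forall r m, occurs t a r -> occurs t a m -> (k %| m - r)%Z) ->
  occurs t 0 r -> (k %| r)%Z.
Proof.
move=> tex kP [v [/root_space0 /vsprojK vE v0 tv]].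
have [a ra av] : exists2 a, fin_roots a & a (vsproj h v) <> 0.
  apply: contrapT => /forall2NP nz; apply: v0; rewrite -vE.
  rewrite (cartan_centerless (H := vsproj h v)) ?linear0// => a ra.
  by have [//|/contrapT] := nz a.
have [m tm] := tex _ ra; rewrite -vE in tv.
by have := kP _ ra _ _ tm (occurs_shift tv av tm); rewrite addrC addKr.
Qed.

End CartanSubalgebras.

(** * The two families as graded subalgebras *)

Definition subroot_grading (P : set (hdual h)) a r : Prop := a = 0 \/ P a.

Lemma subroot_grading_closed (P : set (hdual h)) :
  closed_subroot_system P -> graded_closed (subroot_grading P).
Proof.
move=> [PR _ PD] a b u v r m [->|Pa] [->|Pb] au bv uv; rewrite ?addr0 ?add0r.
- by left.
- by right.
- by right.
- have [ab|ab] := pselect (a + b = 0); first by left.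
  right; apply: PD => //; split=> //; exists [lie u, v] => //.
  exact: root_space_lie.
Qed.

Lemma subroot_graded_regular (P : set (hdual h)) :
  proper_closed_subroot_system P ->
  proper_symmetric_regular h (graded_sub (subroot_grading P)).
Proof.
move=> [cP PT]; have [PR PN _] := subroot_closed_symmetric cP; split.
- by apply: graded_sub_regular; [left|apply: subroot_grading_closed].
- apply: graded_sub_symmetric => a r _ [->|Pa]; first by left; rewrite oppr0.
  by right; apply: PN.
- have [a [ra nPa]] : exists a, fin_roots a /\ ~ P a.
    apply: contrapT => /forallNP nP; apply: PT; apply/seteqP; split=> // a ra.
    by apply: contrapT => nPa; apply: (nP a).
  by apply: (graded_sub_proper (r := 0) ra) => -[/ra.1|].
Qed.

(** Additivity on the root lattice gives F 0 = 0, so the same congruence also describes the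
    imaginary degrees. *)
Definition step_grading (F : hdual h -> int) (k : nat) a r : Prop := (k%:Z %| r - F a)%Z.

Section StepGrading.
Variables (F : hdual h -> int) (k : nat).
Hypothesis FD : forall a b, root_lattice a -> root_lattice b -> F (a + b) = F a + F b.

Let root_latticeW a : fin_roots a -> root_lattice a.
Proof. by move=> ra Q [_]; apply. Qed.

Let root_lattice0 : root_lattice (0 : hdual h). Proof. by move=> Q [[]]. Qed.

Lemma additive_lattice0 : F 0 = 0.
Proof. by apply: (addrI (F 0)); rewrite -FD ?addr0. Qed.

Let weight_lattice a u : root_space a u -> u <> 0 -> root_lattice a.
Proof.
move=> au u0; have [->//|a0] := pselect (a = 0).
by apply: root_latticeW; split=> //; exists u.
Qed.

Lemma step_graded_regular : (k != 1)%N ->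
  proper_symmetric_regular h (graded_sub (step_grading F k)).
Proof.
move=> k1; split.
- apply: graded_sub_regular; first by rewrite /step_grading additive_lattice0 subrr dvdz0.
  move=> a b u v r m; rewrite /step_grading => ar bm au bv uv.
  have u0 : u <> 0 by move=> u0; apply: uv; rewrite u0 lie0l.
  have v0 : v <> 0 by move=> v0; apply: uv; rewrite v0 lie0r.
  rewrite FD; [|exact: weight_lattice au u0|exact: weight_lattice bv v0].
  by rewrite opprD addrACA rpredD.
- apply: graded_sub_symmetric => a r [ra|[-> _]]; rewrite /step_grading; last first.
    by rewrite oppr0 additive_lattice0 !subr0 rpredN.
  have -> : F (- a) = - F a.
    apply/eqP; rewrite -addr_eq0 -FD; last 2 first.
    + by apply: root_latticeW; apply: root_opp.
    + exact: root_latticeW.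
    by rewrite addNr additive_lattice0.
  by rewrite -opprD rpredN.
(* As k does not divide 1, the degree F a + 1 is missing. *)
- have [a ra] := root_ex; apply: (graded_sub_proper (r := F a + 1) ra).
  by rewrite /step_grading addrC addKr dvdz1 absz_nat; apply/negP.
Qed.

End StepGrading.

(** * Enclosing subalgebras and the classification *)

Section RootVectors.
Variable x : hdual h -> L.
Hypothesis xP : root_vectors x.

Lemma subalgebra_of_subroot_systemE (P : set (hdual h)) : P `<=` @fin_roots _ _ h ->
  subalgebra_of_subroot_system B x P = graded_sub (subroot_grading P).
Proof.
move=> PR; apply/seteqP; split.
  apply: lspan_min; first exact: graded_sub_subspace.
  move=> p [[[H _ <-]|[a [r [Pa ->]]]]|[H [r [_ ->]]]].
  - by apply: graded_sub_cartan; left.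
  - by apply: graded_sub_tens (xP (PR _ Pa)).1; right.
  - by apply: (graded_sub_tens (a := 0)); [left|apply/root_space0/subvsP].
rewrite /subalgebra_of_subroot_system; set G := (X in lspan X).
have lG := lspan_subspace G.
have cG (H : aff_cartan h) : lspan G (aff_cartan_val B H).
  by apply: subset_lspan; left; left; exists H.
apply: graded_sub_ind => //.
- suff -> : aff_c B = aff_cartan_val B ((0, 1, 0) : aff_cartan h) by apply: cG.
  rewrite aff_cartan_valE; apply: affP => // m.
  by rewrite -[RHS]/(tens _ _ m) tensE linear0 if_same.
- suff -> : aff_d B = aff_cartan_val B ((0, 0, 1) : aff_cartan h) by apply: cG.
  rewrite aff_cartan_valE; apply: affP => // m.
  by rewrite -[RHS]/(tens _ _ m) tensE linear0 if_same.
move=> a r v [->|Pa] av.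
  rewrite -(vsprojK ((root_space0 v).1 av)); have [->|r0] := pselect (r = 0).
    by have := cG (vsproj h v, 0, 0); rewrite aff_cartan_valE.
  by apply: subset_lspan; right; exists (vsproj h v), r.
have [ax x0] := xP (PR _ Pa); have [c ->] := root_space_line (PR _ Pa) ax x0 av.
apply: (subspaceZ (aff_tens_subspace r lG)) => /=.
by apply: subset_lspan; left; right; exists a, r.
Qed.

Lemma subalgebra_of_functionE (f F : hdual h -> int) (k : nat) : F 0 = 0 ->
  (forall a, fin_roots a -> f a = F a) ->
  subalgebra_of_function B x f k = graded_sub (step_grading F k).
Proof.
move=> F0 fF; apply/seteqP; split.
  apply: lspan_min; first exact: graded_sub_subspace.
  move=> p [[[[a [r [ra ->]]]|[H [r ->]]]|->]|->].
  - apply: graded_sub_tens (xP ra).1.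
    by rewrite /step_grading fF// addrC addKr dvdz_mulr.
  - apply: (graded_sub_tens (a := 0)); last exact/root_space0/subvsP.
    by rewrite /step_grading F0 subr0 dvdz_mulr.
  - exact: graded_sub_c.
  - exact: graded_sub_d.
rewrite /subalgebra_of_function; set G := (X in lspan X); have lG := lspan_subspace G.
apply: graded_sub_ind => //.
- by apply: subset_lspan; left; right.
- by apply: subset_lspan; right.
move=> a r v /dvdzP[q rE] av.
have {rE}rE : r = F a + k%:Z * q by rewrite mulrC -rE addrC subrK.
have [a0|a0] := pselect (a = 0).
  rewrite a0 in av; rewrite -(vsprojK ((root_space0 v).1 av)).
  apply: subset_lspan; left; left; right; exists (vsproj h v), q.
  by rewrite rE a0 F0 add0r.
have [->|v0] := pselect (v = 0); first exact: (subspace0 (aff_tens_subspace r lG)).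
have ra : fin_roots a by split=> //; exists v.
have [ax x0] := xP ra; have [c ->] := root_space_line ra ax x0 av.
apply: (subspaceZ (aff_tens_subspace r lG)) => /=.
by apply: subset_lspan; left; left; left; exists a, q; rewrite fF// -rE.
Qed.

Lemma sub_maximal_subroot t : proper_symmetric_regular h t ->
  (forall H : aff_cartan h, t (aff_cartan_val B H)) ->
  ~ (forall a, fin_roots a -> exists r, occurs t a r) ->
  exists2 P, maximal_closed_subroot_system P & t `<=` graded_sub (subroot_grading P).
Proof.
move=> [rt st tT] ct ntex.
pose P : set (hdual h) := [set a | fin_roots a /\ exists r, occurs t a r].
have cP : closed_symmetric P.
  split=> [a []//|a [ra [r tr]]|a b [ra [r tr]] [rb [m tm]] rab].
    by split; [apply: root_opp|exists (- r); apply: occurs_opp].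
  by split=> //; exists (r + m); apply: occurs_lie.
have [|Q mQ PQ] := maximal_closed_subroot_ex (P := P).
  split; first exact: closed_symmetric_subroot.
  by move=> PE; apply: ntex => a; rewrite -PE => -[].
exists Q => //; apply: sub_graded_sub => //; first by left.
move=> a r [ra|[-> _]] tr; last by left.
by right; apply: PQ; split=> //; exists r.
Qed.

Lemma sub_prime_step t : proper_symmetric_regular h t ->
  (forall H : aff_cartan h, t (aff_cartan_val B H)) ->
  (forall a, fin_roots a -> exists r, occurs t a r) ->
  exists (k : nat) (F : hdual h -> int), [/\ prime k,
    forall a b, root_lattice a -> root_lattice b -> F (a + b) = F a + F b &
    t `<=` graded_sub (step_grading F k)].
Proof.
move=> [rt st tT] ct tex; have [[lt _] _] := rt.
have [k kP] := common_step rt st ct tex.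
have k1 : k <> 1%N.
  move=> k1; apply: tT; apply: (occurs_full rt ct) => a ra r.
  by have [r0 tr0] := tex _ ra; apply/(kP _ ra _ _ tr0); rewrite k1 dvd1z.
have [p pp pk] : exists2 p, prime p & (p %| k)%N.
  (* For k = 0 every prime is a divisor, and 2 is taken. *)
  case: (k) k1 => [|[|k']] k1; [by exists 2|by []|].
  by exists (pdiv k'.+2); [apply: pdiv_prime|apply: pdiv_dvd].
have [F [FD tF]] := @additive_family_lift (fun a r => occurs t a r) tex
  (fun a r ra => occurs_opp st ra)
  (fun a b r m ra rb rab => occurs_lie rt ct ra rb rab).
have tp a : fin_roots a -> forall r m, occurs t a r -> occurs t a m -> (p %| m - r)%Z.
  move=> ra r m tr /(kP _ ra _ _ tr); apply: dvdz_trans.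
  by rewrite dvdzE.
exists p, F; split=> //; apply: sub_graded_sub => //.
  by rewrite /step_grading (additive_lattice0 FD) subrr dvdz0.
move=> a r [ra|[-> _]] tr; rewrite /step_grading; first exact: tp (tF _ ra) tr.
rewrite (additive_lattice0 FD) subr0; exact: (step_occurs0 rt ct tex tp tr).
Qed.

Lemma subroot_graded_maximal (P : set (hdual h)) : maximal_closed_subroot_system P ->
  maximal_symmetric_regular h (graded_sub (subroot_grading P)).
Proof.
move=> [pP maxP]; have psP := subroot_graded_regular pP; split=> // t pt Pt.
have [rt st tT] := pt.
have ct (H : aff_cartan h) : t (aff_cartan_val B H).
  by apply: Pt; apply: graded_sub_cartan; left.
have [PR _ _] := pP.1.
(* All h_a t^r lie in t and a(h_a) = 2, so one degree of a yields every degree; a proper t must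
   therefore miss some root altogether. *)
have all_or_none a r m : fin_roots a -> occurs t a r -> occurs t a m.
  move=> ra tr; rewrite -[m](subrK r) addrC; apply: (occurs_shift rt ct) tr.
    apply: Pt; apply: (graded_sub_tens (a := 0)); first by left.
    exact/root_space0/(subvsP (coroot a)).
  by rewrite root_coroot// => /eqP; rewrite pnatr_eq0.
have [|Q [pQ maxQ] tQ] := sub_maximal_subroot pt ct.
  move=> tex; apply: tT; apply: (occurs_full rt ct) => a ra r.
  by have [m tm] := tex _ ra; apply: all_or_none tm.
have PQ : P `<=` Q.
  move=> a Pa; have [a0 [v av v0]] := PR _ Pa.
  suff [//|//] : subroot_grading Q a 0.
  apply: occurs_graded_sub; apply: sub_occurs tQ _; exists v; split=> //.
  by apply: Pt; apply: graded_sub_tens av; right.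
by apply/seteqP; split=> //; rewrite -(maxP _ pQ PQ).
Qed.

(** A larger t has a common step k', which divides k because F a and F a + k are both degrees of a.
    Primality leaves k' = 1, which gives all of g, or k' = k, which gives equality. *)
Lemma step_graded_maximal F k : prime k ->
  (forall a b, root_lattice a -> root_lattice b -> F (a + b) = F a + F b) ->
  maximal_symmetric_regular h (graded_sub (step_grading F k)).
Proof.
move=> pk FD; have k1 : (k != 1)%N by case: k pk => [|[]].
split; first exact: step_graded_regular.
move=> t pt Ft; have [rt st tT] := pt.
have F0 := additive_lattice0 FD.
have ct (H : aff_cartan h) : t (aff_cartan_val B H).
  by apply: Ft; apply: graded_sub_cartan; rewrite /step_grading F0 subrr dvdz0.
have tF a r : fin_roots a -> (k %| r - F a)%Z -> occurs t a r.
  move=> [a0 [v av v0]] kr; exists v; split=> //.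
  by apply: Ft; apply: graded_sub_tens av.
have tex a : fin_roots a -> exists r, occurs t a r.
  by move=> ra; exists (F a); apply: tF; rewrite // subrr dvdz0.
have [k' kP] := common_step rt st ct tex.
have k'k : k' = k.
  have [a ra] := root_ex.
  have tFa : occurs t a (F a) by apply: tF; rewrite // subrr dvdz0.
  have : (k' %| k)%N.
    have /(kP _ ra _ _ tFa) : occurs t a (F a + k%:Z).
      by apply: tF; rewrite // addrC addKr dvdzz.
    by rewrite addrC addKr.
  case/primeP: pk => _ /[apply] /orP[/eqP k'1|/eqP//].
  case: tT; apply: (occurs_full rt ct) => b rb r; have [m tm] := tex _ rb.
  by apply/(kP _ rb _ _ tm); rewrite k'1 dvd1z.
subst k'; apply/seteqP; split=> //; apply: sub_graded_sub => //.
  by rewrite /step_grading F0 subrr dvdz0.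
move=> a r [ra|[-> _]] tr; rewrite /step_grading.
  by apply/(kP _ ra _ _ _) => //; apply: tF; rewrite // subrr dvdz0.
rewrite F0 subr0; apply: (step_occurs0 rt ct tex) tr => a' ra' r' m' tr'.
by move/(kP _ ra' _ _ tr').
Qed.

Lemma maximal_symmetric_regularP t : maximal_symmetric_regular h t <->
  [\/ t = derived_algebra (affine B),
      exists Psi : set (hdual h), maximal_closed_subroot_system Psi /\
        t = subalgebra_of_subroot_system B x Psi |
      exists (k : nat) (f : hdual h -> int),
        [/\ prime k, Zlinear_on_roots f & t = subalgebra_of_function B x f k]].
Proof.
split=> [mt|].
  have [tD|ct] := maximal_contains_cartan mt; [exact: Or31|].
  have [pt tmax] := mt; have [rt st tT] := pt.
  have [tex|ntex] := pselect (forall a, fin_roots a -> exists r, occurs t a r).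
    apply: Or33; have [k [F [pk FD tF]]] := sub_prime_step pt ct tex.
    have k1 : (k != 1)%N by case: k pk {tF} => [|[]].
    exists k, F; split=> //; first by exists F.
    rewrite (subalgebra_of_functionE (F := F))//; last exact: additive_lattice0.
    by apply/esym/tmax => //; apply: step_graded_regular.
  apply: Or32; have [P mP tP] := sub_maximal_subroot pt ct ntex.
  exists P; split=> //; have [[cP _] _] := mP.
  rewrite subalgebra_of_subroot_systemE; last by case: cP.
  by apply/esym/tmax => //; apply: subroot_graded_regular; case: mP.
case=> [->|[P [mP ->]]|[k [f [pk [F [FD fF]] ->]]]].
- exact: derived_algebra_maximal.
- rewrite subalgebra_of_subroot_systemE; first exact: subroot_graded_maximal.
  by case: mP => -[[]].
- rewrite (subalgebra_of_functionE (F := F))//; last exact: additive_lattice0.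
  exact: step_graded_maximal.
Qed.

End RootVectors.
End RootTheory.

Theorem theorem4 (R : realType) (L : vectLieType R[i]) (h : {vspace L})
    (x : hdual h -> L) (B : invariant_form L) (s : set (affine B)) :
  simple_lie L -> cartan h -> root_vectors x ->
  maximal_symmetric_regular h s <->
  [\/ s = derived_algebra (affine B),
      exists Psi : set (hdual h), maximal_closed_subroot_system Psi /\
        s = subalgebra_of_subroot_system B x Psi |
      exists (k : nat) (f : hdual h -> int),
        [/\ prime k, Zlinear_on_roots f & s = subalgebra_of_function B x f k]].
Proof.
move=> simL Ch xP; have [b bb bP] := weight_basis Ch.
have [w wP] : {w : 'I_(size b) -> hdual h & forall i, root_space (w i) (in_tuple b)`_i}.
  apply: (@choice _ _ (fun (i : 'I_(size b)) a => root_space a (in_tuple b)`_i)) => i.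
  by apply: bP; rewrite mem_nth.
exact: (maximal_symmetric_regularP simL Ch (e := in_tuple b) bb wP xP).
Qed.
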